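(* Let $A\in \mathbb{M}_{m\times n}(\mathbb{C})\setminus\{0\}$, let $2\leq p<\infty$ and $1\le k\le n_0=\min\{m,n\}$. Then $$\partial\|A\|_{(p,k)}=\operatorname{conv}\Big\{\tfrac{1}{\|A\|_{(p,k)}^{p-1}}\,A(A^*A)^{\frac{p-2}{2}}\sum_{i=1}^{k}v_iv_i^* \;:\; v_1,\ldots,v_k\in\mathbb{C}^n \text{ orthonormal with } A^*Av_i=\sigma_i^2(A)v_i \text{ for all } 1\leq i\leq k\Big\}.$$
   Context: $\mathbb{M}_{m\times n}(\mathbb{C})$ is the space of complex $m\times n$ matrices, $n_0=\min\{m,n\}$, and $\sigma_1(A)\ge\cdots\ge\sigma_{n_0}(A)$ are the singular values of $A$. For $1\le p<\infty$ and $1\le k\le n_0$ the Ky Fan $p$-$k$ norm is $\|A\|_{(p,k)}=(\sigma_1^p(A)+\cdots+\sigma_k^p(A))^{1/p}$. The subdifferential of a norm $\|\cdot\|$ at $A$, with functionals identified with matrices through $X\mapsto \operatorname{tr}(G^*X)$, is the set $\partial\|A\|=\{G\in\mathbb{M}_{m\times n}(\mathbb{C}): \operatorname{Re}\operatorname{tr}(G^*(X-A))\le\|X\|-\|A\|\text{ for all }X\in\mathbb{M}_{m\times n}(\mathbb{C})\}$. For $p=2$, $(A^*A)^{0}$ is the identity matrix. $\operatorname{conv}$ denotes convex hull. *)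

(* Defs.v *)
From HB Require Import structures.
From mathcomp Require Import all_boot all_order all_algebra.
From mathcomp Require Import complex.
From mathcomp Require Import boolp classical_sets reals exp convex.
Set Implicit Arguments.
Unset Strict Implicit.
Unset Printing Implicit Defensive.
Import Order.TTheory GRing.Theory Num.Theory.
Local Open Scope ring_scope.
Local Open Scope complex_scope.
Local Open Scope sesquilinear_scope.
Local Open Scope classical_set_scope.

(* [M ^t*] is the conjugate transpose M^*.  A square matrix M that is Hermitian
   is P^-1 * diag(d) * P with P = [spectralmx M] unitary and
   d = [spectral_diag M] real; [complex.Re] only moves the eigenvalues from
   R[i] to R. *)

(* Counted from 0: [singval A i] is sigma_(i+1)(A), the square root of the
   (i+1)-th largest eigenvalue of A^* A, with multiplicity.  Those with index
   at least min(m, n) are 0. *)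
Definition singval (R : realType) (m n : nat) (A : 'M[R[i]]_(m, n)) (i : nat)
    : R :=
  nth 0 (sort >=%R [seq Num.sqrt (complex.Re (spectral_diag (A^t* *m A) 0 j))
                   | j <- enum 'I_n]) i.

Definition kyfan (R : realType) (m n : nat) (p : R) (k : nat)
    (A : 'M[R[i]]_(m, n)) : R :=
  (\sum_(i < k) singval A i `^ p) `^ p^-1.

(* Spectral (functional calculus) power M^s of a positive semidefinite M.
   As 0 `^ 0 = 1, M^0 is the identity also when M is singular. *)
Definition psdpow (R : realType) (n : nat) (M : 'M[R[i]]_n) (s : R)
    : 'M[R[i]]_n :=
  invmx (spectralmx M)
  *m diag_mx (\row_j (complex.Re (spectral_diag M 0 j) `^ s)%:C)
  *m spectralmx M.

Definition subdifferential (R : realType) (m n : nat)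
    (N : 'M[R[i]]_(m, n) -> R) (A : 'M[R[i]]_(m, n)) : set 'M[R[i]]_(m, n) :=
  [set G | forall X : 'M[R[i]]_(m, n),
     complex.Re (\tr (G^t* *m (X - A))) <= N X - N A].

(* The smallest convex set containing S.  For M over R[i] the weights lambda
   of [convex_set] satisfy 0 <= lambda <= 1 in R[i], hence are real. *)
Definition conv_hull (K : numDomainType) (M : lmodType K) (S : set M) : set M :=
  smallest (@convex_set K M) S.

Definition orthonormal_fam (R : realType) (n k : nat) (v : 'I_k -> 'cV[R[i]]_n)
    : Prop :=
  forall i j : 'I_k, (v i)^t* *m v j = (i == j)%:R%:M.

(* Main.v *)
(* Write sigma_i for the singular values of A, s = sigma_k, N for the norm, and
   c = N(A)^(1-p).

   For p >= 2, N(X)^p is the maximum of sum_i |X v_i|^p over orthonormal families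
   v_1, ..., v_k (Jensen's inequality and Ky Fan's principle).  With the
   inequalities of Cauchy-Schwarz and Hoelder, this makes each matrix of the
   right-hand side a subgradient, and the subdifferential is convex.

   Conversely let G be a subgradient.  As N is unitarily invariant, G^*A and AG^*
   are positive semidefinite, so G^*A commutes with A^*A and there are a common
   eigenbasis v_j and vectors w_j with A v_j = sigma_j w_j, G v_j = g_j w_j.
   Changing one singular value of A at a time gives g_j = c t_j sigma_j^(p-1) with
   0 <= t_j <= 1, t_j = 1 if sigma_j > s, t_j = 0 if sigma_j < s, and
   sum_j t_j = k.  Finally, t is a convex combination of 0/1 vectors with the same
   constraints, and each of these corresponds to a choice of k eigenvectors. *)
Require Import Defs.
From HB Require Import structures.
From mathcomp Require Import all_boot all_order all_algebra.
From mathcomp Require Import complex.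
From mathcomp Require Import boolp classical_sets reals exp convex.
From mathcomp Require Import interval_inference ring lra.
Set Implicit Arguments.
Unset Strict Implicit.
Unset Printing Implicit Defensive.
Import Order.TTheory GRing.Theory Num.Theory.
Local Open Scope ring_scope.
Local Open Scope complex_scope.
Local Open Scope sesquilinear_scope.
Local Open Scope classical_set_scope.

(** * Adjoints, the inner product on columns, and the Cauchy-Schwarz inequality *)

Section Adjoint.
Variable R : realType.
Local Notation C := R[i].

Lemma adjM m n q (A : 'M[C]_(m, n)) (B : 'M[C]_(n, q)) :
  (A *m B)^t* = B^t* *m A^t*.
Proof. by rewrite trmx_mul map_mxM. Qed.

Lemma adjD m n (A B : 'M[C]_(m, n)) : (A + B)^t* = A^t* + B^t*.
Proof. by rewrite linearD /= map_mxD. Qed.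

Lemma adjZ m n (a : C) (A : 'M[C]_(m, n)) : (a *: A)^t* = conjc a *: A^t*.
Proof. by rewrite linearZ /= map_mxZ. Qed.

Lemma adjZr m n (a : R) (A : 'M[C]_(m, n)) : (a%:C *: A)^t* = a%:C *: A^t*.
Proof. by rewrite adjZ conjc_real. Qed.

Lemma adj0 m n : (0 : 'M[C]_(m, n))^t* = 0.
Proof. by rewrite trmx0 map_mx0. Qed.

Lemma adj1 n : (1%:M : 'M[C]_n)^t* = 1%:M.
Proof. by rewrite trmx1 map_mx1. Qed.

Lemma adj_sum m n I r (P : pred I) (F : I -> 'M[C]_(m, n)) :
  (\sum_(i <- r | P i) F i)^t* = \sum_(i <- r | P i) (F i)^t*.
Proof. by elim/big_rec2: _ => [|i x y _ <-]; rewrite ?adj0 ?adjD. Qed.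

Definition ip n (u v : 'cV[C]_n) : C := (u^t* *m v) 0 0.
Definition nsq n (v : 'cV[C]_n) : R := complex.Re (ip v v).

Lemma ipE n (u v : 'cV[C]_n) : u^t* *m v = (ip u v)%:M.
Proof. exact: mx11_scalar. Qed.

Lemma ipDr n (u v w : 'cV[C]_n) : ip u (v + w) = ip u v + ip u w.
Proof. by rewrite /ip mulmxDr mxE. Qed.

Lemma ipDl n (u v w : 'cV[C]_n) : ip (v + w) u = ip v u + ip w u.
Proof. by rewrite /ip adjD mulmxDl mxE. Qed.

Lemma ipZr n (u v : 'cV[C]_n) a : ip u (a *: v) = a * ip u v.
Proof. by rewrite /ip -scalemxAr mxE. Qed.

Lemma ipZl n (u v : 'cV[C]_n) a : ip (a *: u) v = conjc a * ip u v.
Proof. by rewrite /ip adjZ -scalemxAl mxE. Qed.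

Lemma ipNr n (u v : 'cV[C]_n) : ip u (- v) = - ip u v.
Proof. by rewrite /ip mulmxN mxE. Qed.

Lemma ip0r n (u : 'cV[C]_n) : ip u 0 = 0.
Proof. by rewrite /ip mulmx0 mxE. Qed.

Lemma ip0l n (u : 'cV[C]_n) : ip 0 u = 0.
Proof. by rewrite /ip adj0 mul0mx mxE. Qed.

Lemma ip_sumr n I r (P : pred I) (F : I -> 'cV[C]_n) u :
  ip u (\sum_(i <- r | P i) F i) = \sum_(i <- r | P i) ip u (F i).
Proof. by elim/big_rec2: _ => [|i x y _ <-]; rewrite ?ip0r ?ipDr. Qed.

Lemma ip_suml n I r (P : pred I) (F : I -> 'cV[C]_n) u :
  ip (\sum_(i <- r | P i) F i) u = \sum_(i <- r | P i) ip (F i) u.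
Proof. by elim/big_rec2: _ => [|i x y _ <-]; rewrite ?ip0l ?ipDl. Qed.

Lemma ip_conj n (u v : 'cV[C]_n) : ip v u = conjc (ip u v).
Proof.
rewrite /ip -[in LHS](trmxCK v) -[in RHS](trmxCK u).
rewrite -{1}(trmxCK u) !trmxCK.
have -> : v^t* *m u = (u^t* *m v)^t* by rewrite adjM trmxCK.
by rewrite !mxE.
Qed.

Lemma ip_adjl m n (A : 'M[C]_(m, n)) u v : ip u (A *m v) = ip (A^t* *m u) v.
Proof. by rewrite /ip adjM trmxCK mulmxA. Qed.

Lemma ip_adjr m n (A : 'M[C]_(m, n)) u v : ip (A *m u) v = ip u (A^t* *m v).
Proof. by rewrite ip_adjl trmxCK. Qed.

Lemma ip_nsq n (v : 'cV[C]_n) : ip v v = (nsq v)%:C.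
Proof.
rewrite /nsq; apply/esym/RRe_real/ger0_real.
by rewrite /ip mxE sumr_ge0 // => i _; rewrite !mxE mulrC mulcJ_ge0.
Qed.

Lemma nsq_ge0 n (v : 'cV[C]_n) : 0 <= nsq v.
Proof.
rewrite -lecR -ip_nsq /ip mxE sumr_ge0 // => i _.
by rewrite !mxE mulrC mulcJ_ge0.
Qed.

Lemma nsq_eq0 n (v : 'cV[C]_n) : nsq v = 0 -> v = 0.
Proof.
move=> v0; have : ip v v = 0 by rewrite ip_nsq v0.
rewrite /ip mxE => /eqP; rewrite psumr_eq0; last first.
  by move=> i _; rewrite !mxE mulrC mulcJ_ge0.
move=> /allP h; apply/colP => i; rewrite [RHS]mxE.
have := h i; rewrite mem_index_enum => /(_ isT) /=.
by rewrite !mxE mulf_eq0 conjC_eq0 orbb => /eqP.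
Qed.

Lemma Re_mulcJ (a : C) : (complex.Re (a * conjc a))%:C = a * conjc a.
Proof. exact/RRe_real/ger0_real/mulcJ_ge0. Qed.

Lemma nsqZ n (a : C) (v : 'cV[C]_n) :
  nsq (a *: v) = complex.Re (a * conjc a) * nsq v.
Proof.
by apply: complexI; rewrite -ip_nsq ipZr ipZl ip_nsq mulrA rmorphM /= Re_mulcJ.
Qed.

Lemma ReM (a : R) (z : C) : complex.Re (a%:C * z) = a * complex.Re z.
Proof. by case: z => x y /=; rewrite mul0r subr0. Qed.

Lemma ReD (x y : C) : complex.Re (x + y) = complex.Re x + complex.Re y.
Proof. by case: x y => [? ?] [? ?]. Qed.

Lemma ReN (x : C) : complex.Re (- x) = - complex.Re x.
Proof. by case: x => [? ?]. Qed.

Lemma Re_conj (x : C) : complex.Re (conjc x) = complex.Re x.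
Proof. by case: x => [? ?]. Qed.

Lemma Re_sum I r (P : pred I) (F : I -> C) :
  complex.Re (\sum_(i <- r | P i) F i) = \sum_(i <- r | P i) complex.Re (F i).
Proof. by elim/big_rec2: _ => [|i x y _ <-]; rewrite ?ReD. Qed.

Lemma nsqD n (u v : 'cV[C]_n) :
  nsq (u + v) = nsq u + nsq v + 2 * complex.Re (ip u v).
Proof.
by rewrite /nsq ipDr !ipDl (ip_conj u v) !ReD Re_conj; ring.
Qed.

Lemma nsqZr n (a : R) (v : 'cV[C]_n) : nsq (a%:C *: v) = a ^+ 2 * nsq v.
Proof. by rewrite nsqZ conjc_real ReM /= expr2. Qed.

Lemma cauchy_schwarz n (u v : 'cV[C]_n) :
  complex.Re (ip u v) <= Num.sqrt (nsq u) * Num.sqrt (nsq v).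
Proof.
set a := Num.sqrt (nsq u); set b := Num.sqrt (nsq v).
have a2 : a ^+ 2 = nsq u by rewrite sqr_sqrtr ?nsq_ge0.
have b2 : b ^+ 2 = nsq v by rewrite sqr_sqrtr ?nsq_ge0.
have [a0|a_neq0] := eqVneq a 0.
  rewrite (nsq_eq0 (v := u)) ?ip0l /= ?mulr_ge0 ?sqrtr_ge0 //.
  by rewrite -a2 a0 expr0n.
have [b0|b_neq0] := eqVneq b 0.
  rewrite (nsq_eq0 (v := v)) ?ip0r /= ?mulr_ge0 ?sqrtr_ge0 //.
  by rewrite -b2 b0 expr0n.
have a_gt0 : 0 < a by rewrite lt_neqAle eq_sym a_neq0 sqrtr_ge0.
have b_gt0 : 0 < b by rewrite lt_neqAle eq_sym b_neq0 sqrtr_ge0.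
(* With a = |u| and b = |v|, the square of |b u - a v| is 2ab (ab - Re <u, v>). *)
have := nsq_ge0 (b%:C *: u + (- a)%:C *: v).
rewrite nsqD !nsqZr ipZl ipZr conjc_real mulrA -rmorphM ReM -a2 -b2 => h.
have : 0 <= (a * b) * (a * b - complex.Re (ip u v)) by lra.
by rewrite pmulr_rge0 ?mulr_gt0 // subr_ge0.
Qed.

Lemma rank1_mulmx m n (u : 'cV[C]_m) (v w : 'cV[C]_n) :
  u *m v^t* *m w = ip v w *: u.
Proof. by rewrite -mulmxA ipE mul_mx_scalar. Qed.

Lemma trace_rank1 n (u v : 'cV[C]_n) : \tr (u *m v^t*) = ip v u.
Proof. by rewrite mxtrace_mulC /mxtrace big_ord1. Qed.

End Adjoint.

(** * Inequalities for real powers *)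

Section Tangent.
Variable R : realType.

(* Convexity of the power function: its graph lies above the tangent at [y]. *)
Lemma powR_tangent (q x y : R) : 1 <= q -> 0 <= x -> 0 <= y ->
  q * (y `^ (q - 1) * x) <= x `^ q + (q - 1) * y `^ q.
Proof.
move=> q1 x0 y0; have q0 : 0 < q by lra.
have [q_eq1|q_neq1] := eqVneq q 1.
  by rewrite q_eq1 subrr powRr0 powRr1 // !mul1r mul0r addr0.
have q1' : 0 < q - 1 by rewrite subr_gt0 lt_neqAle eq_sym q_neq1.
(* Young's inequality for x and y^(q-1), with the conjugate exponents q and q/(q-1). *)
have := @conjugate_powR R x (y `^ (q - 1)) q (q / (q - 1)) x0 (powR_ge0 _ _)
  q0 (divr_gt0 q0 q1').
rewrite -powRrM mulrCA divff ?gt_eqF // mulr1.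
have -> : q^-1 + (q / (q - 1))^-1 = 1 by field; rewrite gt_eqF ?gt_eqF.
move=> /(_ erefl) /(ler_wpM2l (ltW q0)); rewrite [x * _]mulrC => h.
apply: le_trans h _; rewrite le_eqVlt; apply/orP; left; apply/eqP.
by field; rewrite !gt_eqF.
Qed.

Lemma powR_le2 (r x y : R) : 0 <= r -> 0 <= x -> x <= y -> x `^ r <= y `^ r.
Proof.
move=> r0 x0 xy; apply: ge0_ler_powR => //; rewrite nnegrE //.
exact: le_trans xy.
Qed.

Lemma powR_lt2 (r x y : R) : 0 < r -> 0 <= x -> x < y -> x `^ r < y `^ r.
Proof.
move=> r0 x0 xy; apply: gt0_ltr_powR => //; rewrite nnegrE //.
exact: le_trans (ltW xy).
Qed.

Lemma powR_sqr (x r : R) : 0 <= x -> (x ^+ 2) `^ r = x `^ (2 * r).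
Proof. by move=> x0; rewrite powRrM powR_mulrn. Qed.

Lemma powR_invl (x r : R) : 0 <= x -> r != 0 -> (x `^ r^-1) `^ r = x.
Proof. by move=> x0 r0; rewrite -powRrM mulVf // powRr1. Qed.

(* Also valid at [p = 2] and [x = 0], where [0 `^ 0 = 1]. *)
Lemma powR_mulB2 (p x : R) : 2 <= p -> 0 <= x -> x `^ (p - 2) * x = x `^ (p - 1).
Proof.
move=> p2 x0; have -> : p - 2 = p - 1 - 1 by ring.
by rewrite mulrC mulr_powRB1 //; lra.
Qed.

End Tangent.

(** * Orthonormal families and Ky Fan's maximum principle *)

Section Orthonormal.
Variable R : realType.
Local Notation C := R[i].

Lemma ip_orthonormal n k (v : 'I_k -> 'cV[C]_n) (i j : 'I_k) :
  orthonormal_fam v -> ip (v i) (v j) = (i == j)%:R.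
Proof. by move=> ov; rewrite /ip ov mxE eqxx. Qed.

Lemma orthonormalP n k (v : 'I_k -> 'cV[C]_n) :
  (forall i j, ip (v i) (v j) = (i == j)%:R) -> orthonormal_fam v.
Proof. by move=> h i j; rewrite ipE h. Qed.

Lemma nsq_orthonormal n k (v : 'I_k -> 'cV[C]_n) i :
  orthonormal_fam v -> nsq (v i) = 1.
Proof. by move=> ov; rewrite /nsq ip_orthonormal // eqxx. Qed.

Lemma orthonormal_comp n k l (v : 'I_k -> 'cV[C]_n) (e : 'I_l -> 'I_k) :
  injective e -> orthonormal_fam v -> orthonormal_fam (v \o e).
Proof. by move=> ie ov i j; rewrite /= ov inj_eq. Qed.

(** For the matrix V with columns [v j] the sum is V V^*, and V^* V = 1 gives V V^* = 1 because V is
    square. *)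
Lemma onb_sum1 n (v : 'I_n -> 'cV[C]_n) : orthonormal_fam v ->
  \sum_j v j *m (v j)^t* = 1%:M.
Proof.
move=> ov; pose V : 'M[C]_n := \matrix_(i, j) v j i 0.
have VV : V^t* *m V = 1%:M.
  apply/matrixP => i j; rewrite [RHS]mxE -(ip_orthonormal i j ov) /ip !mxE.
  by apply: eq_bigr => l _; rewrite !mxE.
rewrite -(mulmx1C VV); apply/matrixP => i j; rewrite summxE mxE.
by apply: eq_bigr => l _; rewrite !mxE big_ord1 !mxE.
Qed.

Lemma onb_expand n (v : 'I_n -> 'cV[C]_n) x : orthonormal_fam v ->
  x = \sum_j ip (v j) x *: v j.
Proof.
move=> /onb_sum1 h; rewrite -[LHS]mul1mx -h mulmx_suml.
by apply: eq_bigr => j _; rewrite rank1_mulmx.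
Qed.

Lemma onb_ext m n (v : 'I_n -> 'cV[C]_n) (A B : 'M[C]_(m, n)) :
  orthonormal_fam v -> (forall j, A *m v j = B *m v j) -> A = B.
Proof.
move=> /onb_sum1 h AB; rewrite -[A]mulmx1 -[B]mulmx1 -h !mulmx_sumr.
by apply: eq_bigr => j _; rewrite !mulmxA AB.
Qed.

Lemma rank1_sum_mul n k (v : 'I_k -> 'cV[C]_n) (t : 'I_k -> C) i :
  orthonormal_fam v -> (\sum_j t j *: (v j *m (v j)^t*)) *m v i = t i *: v i.
Proof.
move=> ov; rewrite mulmx_suml (bigD1 i) //= big1 ?addr0 => [|j ji].
  by rewrite -scalemxAl rank1_mulmx ip_orthonormal // eqxx scale1r.
by rewrite -scalemxAl rank1_mulmx ip_orthonormal // (negPf ji) scale0r scaler0.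
Qed.

Lemma mxtrace_onb n (v : 'I_n -> 'cV[C]_n) (M : 'M[C]_n) : orthonormal_fam v ->
  \tr M = \sum_j ip (v j) (M *m v j).
Proof.
move=> /onb_sum1 h; rewrite -[M in LHS]mulmx1 -h mulmx_sumr raddf_sum /=.
by apply: eq_bigr => j _; rewrite mulmxA trace_rank1.
Qed.

Definition sqabs (z : C) : R := complex.Re (z * conjc z).

Lemma sqabsE z : (sqabs z)%:C = z * conjc z.
Proof. exact: Re_mulcJ. Qed.

Lemma sqabs_ge0 z : 0 <= sqabs z.
Proof. by rewrite -lecR sqabsE mulcJ_ge0. Qed.

Lemma sqabs_conj z : sqabs (conjc z) = sqabs z.
Proof. by rewrite /sqabs conjcK mulrC. Qed.

Lemma nsq_eigenbasis m n (X : 'M[C]_(m, n)) (v : 'I_n -> 'cV[C]_n) (d : 'I_n -> R) u :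
  orthonormal_fam v -> (forall j, X^t* *m X *m v j = (d j)%:C *: v j) ->
  nsq (X *m u) = \sum_j sqabs (ip (v j) u) * d j.
Proof.
move=> ov Xv; rewrite /nsq ip_adjr mulmxA {2}(onb_expand u ov) mulmx_sumr.
rewrite ip_sumr Re_sum; apply: eq_bigr => j _.
rewrite -scalemxAr Xv !ipZr (ip_conj (v j) u) mulrCA -sqabsE.
by rewrite mulrC ReM.
Qed.

Lemma parseval n (v : 'I_n -> 'cV[C]_n) u : orthonormal_fam v ->
  nsq u = \sum_j sqabs (ip (v j) u).
Proof.
move=> ov; rewrite -{1}[u]mul1mx (@nsq_eigenbasis _ _ _ v (fun=> 1)) //.
  by apply: eq_bigr => j _; rewrite mulr1.
by move=> j; rewrite adj1 !mul1mx scale1r.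
Qed.

(** For the projection y of x to the span of [u], the sum equals both |y|^2 and Re <x, y>; then use
    |x - y|^2 >= 0. *)
Lemma bessel n k (u : 'I_k -> 'cV[C]_n) x : orthonormal_fam u ->
  \sum_i sqabs (ip (u i) x) <= nsq x.
Proof.
move=> ou; pose y := \sum_i ip (u i) x *: u i.
have yx : complex.Re (ip x y) = \sum_i sqabs (ip (u i) x).
  rewrite ip_sumr Re_sum; apply: eq_bigr => i _.
  by rewrite ipZr (ip_conj (u i) x).
have yy : nsq y = \sum_i sqabs (ip (u i) x).
  rewrite /nsq ip_suml Re_sum; apply: eq_bigr => i _.
  rewrite ipZl ip_sumr (bigD1 i) //= big1 ?addr0 => [|j ji].
    by rewrite ipZr ip_orthonormal // eqxx mulr1 mulrC.
  by rewrite ipZr ip_orthonormal // eq_sym (negPf ji) mulr0.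
have := nsq_ge0 (x - y); rewrite nsqD -scaleN1r.
have -> : (-1 : C) = (-1 : R)%:C by rewrite rmorphN rmorph1.
rewrite nsqZr ipZr ReM yx yy; lra.
Qed.

(* Ky Fan's maximum principle for the [q]-th powers, with Jensen's inequality
   applied to the weights [sqabs (ip (v j) (u i))].  The sum of the [k] largest
   numbers among the [d j `^ q] is replaced by its upper bound with a free
   threshold [l], exact when [l] is the [k]-th largest one. *)
Lemma kyfan_principle m n k (X : 'M[C]_(m, n)) (v : 'I_n -> 'cV[C]_n)
    (d : 'I_n -> R) (u : 'I_k -> 'cV[C]_n) (q l : R) :
  orthonormal_fam v -> (forall j, X^t* *m X *m v j = (d j)%:C *: v j) ->
  (forall j, 0 <= d j) -> orthonormal_fam u -> 1 <= q ->
  \sum_i nsq (X *m u i) `^ q <= \sum_j Num.max (d j `^ q - l) 0 + k%:R * l.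
Proof.
move=> ov Xv d0 ou q1.
(* These weights sum to 1 over j (Parseval) and to at most 1 over i (Bessel). *)
pose c i j := sqabs (ip (v j) (u i)).
have c0 i j : 0 <= c i j by exact: sqabs_ge0.
have sc i : \sum_j c i j = 1 by rewrite -parseval // nsq_orthonormal.
have sc' j : \sum_i c i j <= 1.
  rewrite -(nsq_orthonormal j ov); apply: le_trans (bessel (v j) ou).
  by apply: ler_sum => i _; rewrite /c (ip_conj (u i)) sqabs_conj.
have jensen i : nsq (X *m u i) `^ q <= \sum_j c i j * d j `^ q.
  set y := nsq _; have yE : y = \sum_j c i j * d j by exact: nsq_eigenbasis.
  have y0 : 0 <= y by exact: nsq_ge0.
  (* Tangent inequality at the weighted mean y of the [d j], averaged with the weights. *)
  have : \sum_j c i j * (q * (y `^ (q - 1) * d j)) <=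
      \sum_j c i j * (d j `^ q + (q - 1) * y `^ q).
    by apply: ler_sum => j _; rewrite ler_wpM2l // powR_tangent.
  have -> : \sum_j c i j * (q * (y `^ (q - 1) * d j)) = q * y `^ q.
    rewrite -(@mulr_powRB1 _ y q y0); last lra.
    transitivity ((\sum_j c i j * d j) * (q * y `^ (q - 1))).
      by rewrite mulr_suml; apply: eq_bigr => j _; ring.
    by rewrite -yE; ring.
  under [leRHS]eq_bigr do rewrite mulrDr.
  rewrite big_split /= -mulr_suml sc; lra.
apply: le_trans (ler_sum _ (fun i _ => jensen i)) _.
rewrite exchange_big /= -lerBlDr.
(* With k l spread over the same weights, it suffices to treat each j alone: a factor in [0, 1]
   times d_j^q - l is at most the positive part of d_j^q - l. *)
have -> : k%:R * l = \sum_j \sum_i c i j * l.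
  rewrite exchange_big /=; under eq_bigr do rewrite -mulr_suml sc mul1r.
  by rewrite sumr_const card_ord mulr_natl.
rewrite -sumrB; apply: ler_sum => j _.
rewrite -sumrB; under eq_bigr do rewrite -mulrBr; rewrite -mulr_suml.
have s0 : 0 <= \sum_i c i j by rewrite sumr_ge0.
have [h|h] := leP 0 (d j `^ q - l).
  by rewrite ler_piMl.
by rewrite mulr_ge0_le0 // ltW.
Qed.

End Orthonormal.

(** * Eigenbases, singular values and powers of matrices *)

Section Spectral.
Variable R : realType.
Local Notation C := R[i].

Lemma char_poly_conj (F : fieldType) n (P D : 'M[F]_n) : P \in unitmx ->
  char_poly (invmx P *m D *m P) = char_poly D.
Proof.
move=> Pu; rewrite /char_poly /char_poly_mx.
have -> : 'X%:M - map_mx polyC (invmx P *m D *m P) =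
    map_mx polyC (invmx P) *m ('X%:M - map_mx polyC D) *m map_mx polyC P.
  rewrite mulmxBr mulmxBl !map_mxM; congr (_ - _).
  by rewrite scalar_mxC -mulmxA -map_mxM mulVmx // map_mx1 mulmx1.
rewrite !det_mulmx mulrC mulrA -det_mulmx -map_mxM mulmxV // map_mx1 det1.
by rewrite mul1r.
Qed.

Lemma char_poly_diag (F : fieldType) n (d : 'rV[F]_n) :
  char_poly (diag_mx d) = \prod_(x <- [seq d 0 j | j <- enum 'I_n]) ('X - x%:P).
Proof.
rewrite char_poly_trig ?diag_mx_is_trig // big_map big_enum.
by apply: eq_bigr => i _; rewrite mxE eqxx mulr1n.
Qed.

Lemma normalmx_eigenbasis n (N : 'M[C]_n) : N \is normalmx ->
  exists w : 'I_n -> 'cV[C]_n, exists D : 'I_n -> C, [/\ orthonormal_fam w,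
    forall j, N *m w j = D j *: w j &
    forall j, N^t* *m w j = conjc (D j) *: w j].
Proof.
move=> /orthomx_spectralP; have Pu := spectral_unitarymx N.
rewrite invmx_unitary //; set P := spectralmx N in Pu *.
set D := spectral_diag N => NE; have /unitarymxP PP := Pu.
have wE j : (row j P)^t* = P^t* *m delta_mx j 0.
  by rewrite -colE; apply/matrixP => a b; rewrite !mxE.
have eig (E : 'rV[C]_n) j : P^t* *m diag_mx E *m P *m (row j P)^t* = E 0 j *: (row j P)^t*.
  rewrite wE !mulmxA mulmxtVK //= -mulmxA scalemxAr.
  congr (_ *m _); rewrite mul_diag_mx; apply/matrixP => a b; rewrite !mxE.
  by case: eqP => [->|_] //=; rewrite !mulr0.
exists (fun j => (row j P)^t*), (fun j => D 0 j); split.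
- apply: orthonormalP => a b; rewrite /ip trmxCK.
  have := congr1 (fun M : 'M_n => M a b) PP; rewrite [RHS]mxE => <-.
  by rewrite !mxE; apply: eq_bigr => l _; rewrite !mxE.
- by move=> j; rewrite {1}NE eig.
move=> j; have -> : N^t* = P^t* *m diag_mx (map_mx Num.conj D) *m P.
  by rewrite {1}NE !adjM trmxCK mulmxA tr_diag_mx map_diag_mx.
by rewrite eig mxE.
Qed.

Lemma eigenbasis_char_poly n (M : 'M[C]_n) (w : 'I_n -> 'cV[C]_n) (a : 'I_n -> C) :
  orthonormal_fam w -> (forall j, M *m w j = a j *: w j) ->
  char_poly M = \prod_(x <- [seq a j | j <- enum 'I_n]) ('X - x%:P).
Proof.
move=> ow Mw; pose W : 'M[C]_n := \matrix_(i, j) w j i 0.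
have WW : W^t* *m W = 1%:M.
  apply/matrixP => i j; rewrite [RHS]mxE -(ip_orthonormal i j ow) /ip !mxE.
  by apply: eq_bigr => l _; rewrite !mxE.
have WtU : W^t* \in unitmx by have [] := mulmx1_unit WW.
have WE : invmx (W^t*) = W.
  by rewrite -[LHS]mulmx1 -WW mulmxA mulVmx // mul1mx.
have -> : M = invmx (W^t*) *m diag_mx (\row_j a j) *m W^t*.
  rewrite WE; apply: (onb_ext ow) => j.
  have Wtw : W^t* *m w j = delta_mx j 0.
    apply/colP => i; rewrite [RHS]mxE eqxx andbT -(ip_orthonormal i j ow) /ip !mxE.
    by apply: eq_bigr => l _; rewrite !mxE.
  rewrite -[RHS]mulmxA Wtw Mw; apply/colP => i.
  rewrite -colE !mxE (bigD1 j) //= big1 ?addr0.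
    by rewrite !mxE eqxx mulr1n mulrC.
  by move=> l lj; rewrite !mxE (negPf lj) mulr0.
rewrite char_poly_conj // char_poly_diag; congr (\prod_(_ <- _) _).
by apply: eq_map => j; rewrite mxE.
Qed.

Lemma adj_gram m n (X : 'M[C]_(m, n)) : (X^t* *m X)^t* = X^t* *m X.
Proof. by rewrite adjM trmxCK. Qed.

Lemma gram_normal m n (X : 'M[C]_(m, n)) : X^t* *m X \is normalmx.
Proof. by apply/normalmxP; rewrite adj_gram. Qed.

Lemma gram_eigenvalue m n (X : 'M[C]_(m, n)) w (a : R) : nsq w = 1 ->
  X^t* *m X *m w = a%:C *: w -> a = nsq (X *m w).
Proof.
by move=> w1 Xw; rewrite /nsq ip_adjr mulmxA Xw ipZr ip_nsq w1 mulr1.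
Qed.

(** Frees [singval] from the chosen [spectral_diag]: both lists of eigenvalues are the roots of the
    characteristic polynomial, hence permutations of each other, and sorting makes them equal. *)
Lemma singval_perm m n (X : 'M[C]_(m, n)) (w : 'I_n -> 'cV[C]_n) (a : 'I_n -> R) i :
  orthonormal_fam w -> (forall j, X^t* *m X *m w j = (a j)%:C *: w j) ->
  singval X i = nth 0 (sort >=%R [seq Num.sqrt (a j) | j <- enum 'I_n]) i.
Proof.
move=> ow Xw; rewrite /singval; congr nth; apply/perm_sortP.
- by move=> x y /=; exact: le_total.
- by move=> x y z /= h1 h2; exact: le_trans h2 h1.
- by move=> x y /= /andP[h1 h2]; apply/le_anti/andP.
set D := spectral_diag _.
have p : perm_eq [seq D 0 j | j <- enum 'I_n] [seq (a j)%:C | j <- enum 'I_n].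
  apply: prod_XsubC_eq; rewrite -(eigenbasis_char_poly ow Xw) -char_poly_diag.
  have /orthomx_spectralP := gram_normal X => ->.
  by rewrite char_poly_conj // spectral_unit.
have := perm_map (fun z : C => Num.sqrt (complex.Re z)) p.
by rewrite -!map_comp.
Qed.

(* The commuting Hermitian matrices [X^* X] and [H] are the real and imaginary
   parts of one normal matrix, whose eigenbasis serves for both. *)
Lemma singval_eigenbasis m n (X : 'M[C]_(m, n)) (H : 'M[C]_n) :
  H^t* = H -> H *m (X^t* *m X) = X^t* *m X *m H ->
  exists v : 'I_n -> 'cV[C]_n, exists h : 'I_n -> R, [/\ orthonormal_fam v,
    forall j : 'I_n, X^t* *m X *m v j = (singval X j ^+ 2)%:C *: v j &
    forall j, H *m v j = (h j)%:C *: v j].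
Proof.
move=> Hh HX; set M := X^t* *m X in HX *.
pose N := M + 'i%C *: H.
have Nt : N^t* = M - 'i%C *: H.
  rewrite adjD adjZ Hh adj_gram; congr (_ + _); rewrite -scaleNr; congr (_ *: _).
  by rewrite /= ; simpc.
have : N \is normalmx.
  apply/normalmxP; rewrite Nt /N; set K := _ *: H.
  have KM : K *m M = M *m K by rewrite -scalemxAl -scalemxAr HX.
  rewrite !mulmxDl mulNmx !mulmxBr !mulmxDr KM.
  by rewrite addrA subrK opprD addrA addrK.
case/normalmx_eigenbasis => w [D [ow Nw Ntw]].
have two : (2%:R : C) != 0 by rewrite pnatr_eq0.
(* N + N^* = 2 M and N - N^* = 2 i H, so the eigenvalues of M and H are the real and imaginary parts
   of [D j]. *)
have Mw j : M *m w j = (complex.Re (D j))%:C *: w j.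
  apply: (scalerI two); rewrite [RHS]scalerA -addcJ [RHS]scalerDl -Nw -Ntw -mulmxDl Nt.
  by rewrite /N addrACA subrr addr0 mulmxDl scaler_nat mulr2n.
have Hw j : H *m w j = (complex.Im (D j))%:C *: w j.
  have i0 : ('i%C : C) != 0 by rewrite eq_complex /= oner_eq0 andbF.
  have ti : 2%:R * ('i%C : C) != 0 by rewrite mulf_neq0.
  apply: (scalerI ti); rewrite [RHS]scalerA mulrAC -subcJ [RHS]scalerBl -Nw -Ntw -mulmxBl Nt.
  by rewrite /N opprB addrC addrA subrK -scalerA scaler_nat mulr2n mulmxDl scalemxAl.
pose a j := complex.Re (D j); pose f j := Num.sqrt (a j).
have a0 j : 0 <= a j.
  by rewrite /a (gram_eigenvalue (nsq_orthonormal j ow) (Mw j)) nsq_ge0.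
(* The basis is renumbered by decreasing singular value, so that its j-th vector belongs to
   [singval X j]. *)
pose s := sort (relpre f >=%R) (enum 'I_n).
have ss : size s = n by rewrite size_sort size_enum_ord.
have us : uniq s by rewrite sort_uniq enum_uniq.
pose e (j : 'I_n) := nth j s j.
have ie : injective e.
  move=> i j; rewrite /e (set_nth_default j) ?ss // => /eqP.
  by rewrite nth_uniq ?ss // => /eqP /val_inj.
have se (j : 'I_n) : singval X j = f (e j).
  rewrite (singval_perm _ ow Mw) sort_map (nth_map j) //.
  by rewrite size_sort size_enum_ord.
exists (w \o e), (fun j => complex.Im (D (e j))); split.
- exact: orthonormal_comp.
- by move=> j; rewrite /= Mw se sqr_sqrtr.
- by move=> j; rewrite /= Hw.
Qed.

Lemma singval_ge0 m n (X : 'M[C]_(m, n)) i : 0 <= singval X i.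
Proof.
rewrite /singval; set s := sort _ _; have [h|h] := ltnP i (size s).
  have := mem_nth 0 h; rewrite mem_sort => /mapP[j _ ->]; exact: sqrtr_ge0.
by rewrite nth_default.
Qed.

Lemma singval_le m n (X : 'M[C]_(m, n)) i j : (i <= j)%N ->
  singval X j <= singval X i.
Proof.
move=> ij; have [jn|jn] := ltnP j n; last first.
  rewrite {1}/singval nth_default ?singval_ge0 //.
  by rewrite size_sort size_map size_enum_ord.
have tr : transitive (>=%R : rel R) by move=> x y z /= h1 h2; exact: le_trans h2 h1.
rewrite /singval; set s := sort _ _.
have ss : size s = n by rewrite size_sort size_map size_enum_ord.
have : sorted >=%R s by apply: sort_sorted => x y; exact: le_total.
move=> /(sorted_leq_nth tr) /= /(_ (fun=> lexx _) 0 i j).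
by rewrite !inE ss jn (leq_ltn_trans ij jn) => /(_ isT isT ij).
Qed.

(** Holds for every eigenvector, not only for those in [spectralmx M]: in the coordinates y = P v,
    each nonzero y_j forces the j-th spectral value to be d. *)
Lemma psdpow_eigen n (M : 'M[C]_n) (s d : R) (v : 'cV[C]_n) : M \is normalmx ->
  M *m v = d%:C *: v -> psdpow M s *m v = (d `^ s)%:C *: v.
Proof.
move=> /orthomx_spectralP ME Mv; rewrite /psdpow.
have Pu := spectral_unit M; move: Pu ME.
set P := spectralmx M; set D := spectral_diag M => Pu ME; clearbody P D.
set E := \row_j _; pose y := P *m v.
have Dy : diag_mx D *m y = d%:C *: y.
  have PM : P *m M = diag_mx D *m P by rewrite ME -mulmxA mulKVmx.
  by rewrite /y scalemxAr -Mv mulmxA -PM mulmxA.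
have Ey : diag_mx E *m y = (d `^ s)%:C *: y.
  have EE j : E 0 j = (complex.Re (D 0 j) `^ s)%:C by rewrite mxE.
  clearbody E y; apply/colP => j; have := congr1 (fun c : 'cV_n => c j 0) Dy.
  rewrite !mul_diag_mx !mxE EE.
  have [->|y0] := eqVneq (y j 0) 0; first by rewrite !mulr0.
  by move=> /(mulIf y0) ->.
by rewrite -2!mulmxA -[diag_mx E *m _ *m _]mulmxA -/y Ey -scalemxAr mulKmx.
Qed.

End Spectral.

(** * Variational bounds for the Ky Fan norm *)

Section KyFan.
Variables (R : realType) (m n k : nat) (p : R).
Hypotheses (p_ge2 : 2 <= p) (k_gt0 : (0 < k)%N) (k_le_n : (k <= n)%N).
Local Notation C := R[i].
Implicit Types X Y A : 'M[C]_(m, n).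

Let p_neq0 : p != 0.
Proof. by rewrite gt_eqF // (lt_le_trans _ p_ge2). Qed.

Let p_gt0 : 0 < p.
Proof. by rewrite (lt_le_trans _ p_ge2). Qed.

Let p_ge0 : 0 <= p.
Proof. exact: ltW. Qed.

Lemma kyfan_ge0 X : 0 <= kyfan p k X.
Proof. exact: powR_ge0. Qed.

Lemma kyfan_powR X : kyfan p k X `^ p = \sum_(i < k) singval X i `^ p.
Proof.
by rewrite powR_invl // sumr_ge0 // => i _; exact: powR_ge0.
Qed.

(** At the threshold sigma_k^p the bound of [kyfan_principle] is exact: the positive part is the
    plain difference for the first k indices and 0 for the others. Counting from 0, sigma_k has
    index [k.-1]. *)
Lemma sum_threshold X :
  \sum_(j < n) Num.max (singval X j `^ p - singval X k.-1 `^ p) 0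
    + k%:R * singval X k.-1 `^ p = kyfan p k X `^ p.
Proof.
set s := singval X k.-1.
rewrite kyfan_powR (big_ord_widen n (fun i => singval X i `^ p) k_le_n).
rewrite [X in X + _](bigID (fun j : 'I_n => (j < k)%N)) /=.
rewrite [X in _ + X + _]big1 => [|j]; last first.
  rewrite -leqNgt => kj; apply/max_idPr; rewrite subr_le0 powR_le2 ?singval_ge0 //.
  by apply: singval_le; apply: leq_trans kj; exact: leq_pred.
have -> : k%:R * s `^ p = \sum_(j < n | (j < k)%N) s `^ p.
  rewrite -(big_ord_widen n (fun=> s `^ p) k_le_n) sumr_const card_ord.
  by rewrite mulr_natl.
rewrite addr0 -big_split /=; apply: eq_bigr => j jk.
rewrite (max_idPl _) ?subrK // subr_ge0 powR_le2 ?singval_ge0 //.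
by apply: singval_le; rewrite -ltnS prednK.
Qed.

Lemma singval_basis X : exists2 v : 'I_n -> 'cV[C]_n, orthonormal_fam v &
  forall j : 'I_n, X^t* *m X *m v j = (singval X j ^+ 2)%:C *: v j.
Proof.
have [||v [h [ov Xv _]]] := @singval_eigenbasis R m n X 0.
- by rewrite adj0.
- by rewrite mul0mx mulmx0.
by exists v.
Qed.

(** As [nsq] is a squared length, the exponent is p/2; p >= 2 makes it at least 1, as Jensen's
    inequality requires. *)
Lemma sum_nsq_le_kyfan X (y : 'I_k -> 'cV[C]_n) : orthonormal_fam y ->
  \sum_i nsq (X *m y i) `^ (p / 2) <= kyfan p k X `^ p.
Proof.
move=> oy; have [v ov Xv] := singval_basis X; rewrite -sum_threshold.
apply: le_trans (kyfan_principle (singval X k.-1 `^ p) ov Xv _ oy _) _.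
- by move=> j; rewrite sqr_ge0.
- by rewrite ler_pdivlMr ?mul1r.
rewrite lerD2r; apply: ler_sum => j _.
by rewrite powR_sqr ?singval_ge0 // mulrCA divff ?mulr1 ?pnatr_eq0.
Qed.

(** Bounds the norm from any eigenbasis, in any order. The principle for [v] is applied to the first
    k vectors of a sorted eigenbasis, where the sum of powers attains N(X)^p. *)
Lemma kyfan_le_threshold X (v : 'I_n -> 'cV[C]_n) (d : 'I_n -> R) (l : R) :
  orthonormal_fam v -> (forall j, X^t* *m X *m v j = (d j)%:C *: v j) ->
  kyfan p k X `^ p <= \sum_j Num.max (d j `^ (p / 2) - l) 0 + k%:R * l.
Proof.
move=> ov Xv; have [w ow Xw] := singval_basis X.
pose y := w \o widen_ord k_le_n.
have oy : orthonormal_fam y by apply: orthonormal_comp => // i j [] /val_inj.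
have d0 j : 0 <= d j.
  by rewrite (gram_eigenvalue (nsq_orthonormal j ov) (Xv j)) nsq_ge0.
have p2 : 1 <= p / 2 by rewrite ler_pdivlMr ?mul1r.
apply: le_trans (kyfan_principle l ov Xv d0 oy p2).
rewrite kyfan_powR le_eqVlt; apply/orP; left; apply/eqP/eq_bigr => i _.
rewrite -(gram_eigenvalue (nsq_orthonormal _ oy) (Xw (widen_ord k_le_n i))) /=.
by rewrite powR_sqr ?singval_ge0 // mulrCA divff ?mulr1 ?pnatr_eq0.
Qed.

(** The form in which unitary invariance is used: X = Y U satisfies the hypothesis with z = U y, and
    X = U Y with z = y. *)
Lemma kyfan_le X Y :
  (forall y : 'I_k -> 'cV[C]_n, orthonormal_fam y ->
    exists2 z : 'I_k -> 'cV[C]_n, orthonormal_fam z &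
      forall i, nsq (X *m y i) = nsq (Y *m z i)) ->
  kyfan p k X <= kyfan p k Y.
Proof.
move=> XY; have [w ow Xw] := singval_basis X.
pose y := w \o widen_ord k_le_n.
have oy : orthonormal_fam y by apply: orthonormal_comp => // i j [] /val_inj.
have [z oz yz] := XY y oy.
have : kyfan p k X `^ p <= kyfan p k Y `^ p.
  apply: le_trans (sum_nsq_le_kyfan Y oz).
  rewrite kyfan_powR le_eqVlt; apply/orP; left; apply/eqP/eq_bigr => i _.
  rewrite -yz -(gram_eigenvalue (nsq_orthonormal _ oy) (Xw (widen_ord k_le_n i))) /=.
  by rewrite powR_sqr ?singval_ge0 // mulrCA divff ?mulr1 ?pnatr_eq0.
rewrite !leNgt; apply: contraNN => YX.
exact: (powR_lt2 p_gt0 (kyfan_ge0 Y) YX).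
Qed.

(** If the norm vanishes, so does the largest singular value, hence all of them, and A kills an
    eigenbasis. *)
Lemma kyfan_gt0 A : A != 0 -> 0 < kyfan p k A.
Proof.
move=> A0; rewrite lt_neqAle kyfan_ge0 andbT eq_sym; apply: contraNneq A0 => N0.
have : kyfan p k A `^ p = 0 by rewrite N0 powR0.
rewrite kyfan_powR => /eqP; rewrite psumr_eq0 => [|i _]; last exact: powR_ge0.
move=> /allP /(_ (Ordinal k_gt0)); rewrite mem_index_enum => /(_ isT) /=.
rewrite powR_eq0 => /andP[/eqP s0 _].
have [v ov Av] := singval_basis A; apply/eqP; apply: (onb_ext ov) => j.
rewrite mul0mx; apply: nsq_eq0.
rewrite -(gram_eigenvalue (nsq_orthonormal _ ov) (Av j)).
suff -> : singval A j = 0 by rewrite expr0n.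
by apply/le_anti; rewrite singval_ge0 andbT -s0 singval_le.
Qed.

End KyFan.

(** * Matrices of the right-hand side are subgradients *)

Section Superset.
Variable R : realType.
Local Notation C := R[i].

(** Hoelder's inequality with exponents p/(p-1) and p: sum the tangent inequality for x = b/B and y
    = a/N. If B = 0, all [b i] vanish. *)
Lemma holder_sum k (p N B : R) (a b : 'I_k -> R) : 2 <= p -> 0 < N -> 0 <= B ->
  (forall i, 0 <= a i) -> (forall i, 0 <= b i) ->
  \sum_i a i `^ p <= N `^ p -> \sum_i b i `^ p <= B `^ p ->
  \sum_i a i `^ (p - 1) * b i <= N `^ (p - 1) * B.
Proof.
move=> p2 N0 B0 a0 b0 aN bB; have p0 : 0 < p by lra.
have p1 : 1 <= p by lra.
move: B0; rewrite le_eqVlt => /predU1P[B0|B0].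
  have b_eq0 i : b i = 0.
    have : \sum_i b i `^ p == 0.
      rewrite eq_le sumr_ge0 ?andbT => [|j _]; last exact: powR_ge0.
      by rewrite (le_trans bB) // -B0 powR0 ?gt_eqF.
    rewrite psumr_eq0 => [/allP/(_ i)|j _]; last exact: powR_ge0.
    by rewrite mem_index_enum => /(_ isT); rewrite powR_eq0 => /andP[/eqP].
  by rewrite -B0 mulr0 big1 // => i _; rewrite b_eq0 mulr0.
have Np : 0 < N `^ p by rewrite powR_gt0.
have Bp : 0 < B `^ p by rewrite powR_gt0.
have N1 : 0 < N `^ (p - 1) by rewrite powR_gt0.
pose x i := b i / B; pose y i := a i / N.
have xp i : x i `^ p = b i `^ p / B `^ p.
  by rewrite powRM ?invr_ge0 ?(ltW B0) // -powR_inv1 ?(ltW B0) //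
    powRAC powR_inv1 ?powR_ge0.
have yr r i : y i `^ r = a i `^ r / N `^ r.
  by rewrite powRM ?invr_ge0 ?(ltW N0) // -powR_inv1 ?(ltW N0) //
    powRAC powR_inv1 ?powR_ge0.
have x0 i : 0 <= x i by rewrite divr_ge0 // ltW.
have y0 i : 0 <= y i by rewrite divr_ge0 // ltW.
have sx : \sum_i x i `^ p <= 1.
  under eq_bigr do rewrite xp.
  by rewrite -mulr_suml ler_pdivrMr // mul1r.
have sy : \sum_i y i `^ p <= 1.
  under eq_bigr do rewrite yr.
  by rewrite -mulr_suml ler_pdivrMr // mul1r.
have : \sum_i p * (y i `^ (p - 1) * x i) <= \sum_i (x i `^ p + (p - 1) * y i `^ p).
  by apply: ler_sum => i _; exact: powR_tangent.
rewrite big_split /= -!mulr_sumr => h.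
have : p * (\sum_i y i `^ (p - 1) * x i) <= p.
  apply: le_trans h _; have : (p - 1) * (\sum_i y i `^ p) <= p - 1.
    by rewrite ler_piMr //; lra.
  lra.
rewrite -[leRHS]mulr1 ler_pM2l // => h2.
have -> : \sum_i a i `^ (p - 1) * b i =
    N `^ (p - 1) * B * \sum_i y i `^ (p - 1) * x i.
  rewrite mulr_sumr; apply: eq_bigr => i _; rewrite yr /x.
  by field; rewrite !gt_eqF.
by rewrite ler_piMr // mulr_ge0 // ltW.
Qed.

Lemma convex_lmodE (K : numDomainType) (M : lmodType K) (x y : convex_lmodType M)
    (l : {i01 K}) : conv l x y = l%:num *: (x : M) + (1 - l%:num) *: (y : M) :> M.
Proof. by []. Qed.

Lemma i01_real (l : {i01 C}) : exists2 r : R, l%:num = r%:C & 0 <= r <= 1.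
Proof.
have l0 : 0 <= l%:num :> C by [].
have l1 : l%:num <= 1 :> C by [].
exists (complex.Re l%:num); first by rewrite RRe_real // ger0_real.
by rewrite -!lecR RRe_real ?ger0_real // l0 l1.
Qed.

(** The real part of the Frobenius inner product. *)
Definition tip m n (G X : 'M[C]_(m, n)) : R := complex.Re (\tr (G^t* *m X)).

Lemma tipDl m n (G H X : 'M[C]_(m, n)) : tip (G + H) X = tip G X + tip H X.
Proof. by rewrite /tip adjD mulmxDl mxtraceD ReD. Qed.

Lemma tipDr m n (G X Y : 'M[C]_(m, n)) : tip G (X + Y) = tip G X + tip G Y.
Proof. by rewrite /tip mulmxDr mxtraceD ReD. Qed.

Lemma tipNr m n (G X : 'M[C]_(m, n)) : tip G (- X) = - tip G X.
Proof. by rewrite /tip mulmxN raddfN ReN. Qed.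

Lemma tipZl m n (r : R) (G X : 'M[C]_(m, n)) : tip (r%:C *: G) X = r * tip G X.
Proof. by rewrite /tip adjZr -scalemxAl mxtraceZ ReM. Qed.

Lemma tipZr m n (r : R) (G X : 'M[C]_(m, n)) : tip G (r%:C *: X) = r * tip G X.
Proof. by rewrite /tip -scalemxAr mxtraceZ ReM. Qed.

Lemma tip_suml m n k (F : 'I_k -> 'M[C]_(m, n)) X :
  tip (\sum_i F i) X = \sum_i tip (F i) X.
Proof.
by rewrite /tip adj_sum mulmx_suml [\tr _]raddf_sum Re_sum.
Qed.

Lemma tip_rank1 m n (u : 'cV[C]_m) (v : 'cV[C]_n) X :
  tip (u *m v^t*) X = complex.Re (ip u (X *m v)).
Proof. by rewrite /tip adjM trmxCK mxtrace_mulC mulmxA trace_rank1 ip_conj Re_conj. Qed.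

Lemma subdifferential_convex m n (N : 'M[C]_(m, n) -> R) A :
  convex_set (subdifferential N A).
Proof.
move=> G H l /set_mem hG /set_mem hH; apply/mem_set => X.
rewrite convex_lmodE; have [r -> /andP[r0 r1]] := i01_real l.
have -> : 1 - r%:C = (1 - r)%:C by rewrite rmorphB rmorph1.
rewrite -/(tip _ _) tipDl !tipZl.
have h1 := ler_wpM2l r0 (hG X).
have h2 : (1 - r) * tip H (X - A) <= (1 - r) * (N X - N A).
  by rewrite ler_wpM2l ?subr_ge0 //; exact: hH.
rewrite -/(tip _ _) in h1; lra.
Qed.

Section Kyfan.
Variables (m n k : nat) (p : R) (A : 'M[C]_(m, n)).
Hypotheses (p_ge2 : 2 <= p) (k_gt0 : (0 < k)%N) (k_le_n : (k <= n)%N) (A_neq0 : A != 0).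
Local Notation M := (A^t* *m A).
Local Notation N := (kyfan p k).

Let p_gt0 : 0 < p.
Proof. by rewrite (lt_le_trans _ p_ge2). Qed.

Definition kyfan_face (v : 'I_k -> 'cV[C]_n) : 'M[C]_(m, n) :=
  ((N A `^ (p - 1))^-1)%:C
    *: (A *m psdpow M ((p - 2) / 2) *m \sum_(i < k) (v i *m (v i)^t*)).

Lemma psdpow_singval (s : R) (v : 'cV[C]_n) : 0 <= s -> M *m v = (s ^+ 2)%:C *: v ->
  psdpow M ((p - 2) / 2) *m v = (s `^ (p - 2))%:C *: v.
Proof.
move=> s0 Mv; rewrite (psdpow_eigen _ (gram_normal A) Mv) powR_sqr //.
by rewrite mulrCA divff ?mulr1 // pnatr_eq0.
Qed.

(** Pairing with this matrix gives exactly N(A) at A and at most N(X) at X. *)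
Lemma kyfan_face_sub v : orthonormal_fam v ->
  (forall i : 'I_k, M *m v i = (singval A i ^+ 2)%:C *: v i) ->
  subdifferential N A (kyfan_face v).
Proof.
move=> ov Av X; rewrite -/(tip _ _) tipDr tipNr.
have N0 : 0 < N A by exact: kyfan_gt0.
have N1 : 0 < N A `^ (p - 1) by exact: powR_gt0.
have s0 i : 0 <= singval A i by exact: singval_ge0.
have tipE Y : tip (kyfan_face v) Y = (N A `^ (p - 1))^-1 *
    \sum_(i < k) singval A i `^ (p - 2) * complex.Re (ip (A *m v i) (Y *m v i)).
  rewrite /kyfan_face tipZl mulmx_sumr tip_suml; congr (_ * _).
  apply: eq_bigr => i _; rewrite mulmxA -[A *m _ *m _]mulmxA
    (psdpow_singval (s0 i) (Av i)).
  by rewrite -scalemxAr -scalemxAl tipZl tip_rank1.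
have sA (i : 'I_k) : singval A i ^+ 2 = nsq (A *m v i).
  exact: (gram_eigenvalue (nsq_orthonormal i ov) (Av i)).
have -> : tip (kyfan_face v) A = N A.
  rewrite tipE; apply: (mulfI (lt0r_neq0 N1)).
  rewrite (mulVKf (lt0r_neq0 N1)) [RHS]mulrC (mulr_powRB1 (ltW N0) p_gt0).
  rewrite kyfan_powR //; apply: eq_bigr => i _.
  by rewrite -/(nsq _) -sA expr2 mulrA (powR_mulB2 p_ge2 (s0 i)) mulrC
    (mulr_powRB1 (s0 i) p_gt0).
rewrite lerD2r tipE mulrC ler_pdivrMr // mulrC.
pose b i := Num.sqrt (nsq (X *m v i)).
(* Cauchy-Schwarz with |A v_i| = sigma_i supplies the missing factor sigma_i. Hoelder's inequality
   and the variational bound for X follow. *)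
apply: le_trans (_ : \sum_(i < k) singval A i `^ (p - 1) * b i <= _).
  apply: ler_sum => i _; rewrite -powR_mulB2 // -mulrA ler_wpM2l ?powR_ge0 //.
  by apply: le_trans (cauchy_schwarz _ _) _; rewrite -sA sqrtr_sqr ger0_norm.
apply: (holder_sum p_ge2 N0 (kyfan_ge0 k p X) (fun i => s0 i)).
- by move=> i; exact: sqrtr_ge0.
- by rewrite kyfan_powR.
apply: le_trans (sum_nsq_le_kyfan p_ge2 k_gt0 k_le_n X ov).
apply: ler_sum => i _; rewrite /b -powR12_sqrt ?nsq_ge0 // -powRrM.
by rewrite mulrC.
Qed.

End Kyfan.
End Superset.

(** * Positivity from phase tests, and one-variable subgradients *)

Section Positivity.
Variable R : realType.
Local Notation C := R[i].

Lemma conjcM (a b : C) : conjc (a * b) = conjc a * conjc b.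
Proof. exact: rmorphM. Qed.

Lemma conjc_ge0 (z : C) : 0 <= z -> conjc z = z.
Proof. by case: z => x y; rewrite lecE /= => /andP[/eqP -> _]; rewrite oppr0. Qed.

(** The phase z = conj w / |w| turns w into |w|, so |w| <= Re w, which forces w = |w|. *)
Lemma ge0_of_phase (w : C) :
  (forall z : C, conjc z * z = 1 -> complex.Re ((z - 1) * w) <= 0) -> 0 <= w.
Proof.
have [->|w0] := eqVneq w 0; first by rewrite lexx.
have n0 : `|w| != 0 by rewrite normr_eq0.
move=> /(_ (conjc w / `|w|)).
have nE : `|w| = (Num.sqrt ((complex.Re w) ^+ 2 + (complex.Im w) ^+ 2))%:C.
  exact: normc_def.
have nJ : conjc `|w| = `|w| by rewrite nE conjc_real.
have ww : w * conjc w = `|w| * `|w| by rewrite -sqr_normc expr2.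
have -> : conjc (conjc w / `|w|) * (conjc w / `|w|) = 1.
  have -> : conjc (conjc w / `|w|) = w / `|w|.
    by rewrite conjcM conjcK conjc_inv nJ.
  rewrite mulrACA ww -invfM divff //.
  by rewrite mulf_neq0.
have -> : (conjc w / `|w| - 1) * w = `|w| - w.
  by rewrite mulrBl mul1r mulrAC [_ * w]mulrC ww mulfK.
move=> /(_ erefl); rewrite ReD ReN nE /= subr_le0.
set r := Num.sqrt _ => rw; have r0 : 0 <= r by exact: sqrtr_ge0.
have r2 : r ^+ 2 = (complex.Re w) ^+ 2 + (complex.Im w) ^+ 2.
  by rewrite sqr_sqrtr // addr_ge0 ?sqr_ge0.
have i0 : complex.Im w = 0.
  have : r ^+ 2 <= (complex.Re w) ^+ 2 by rewrite ler_sqr ?nnegrE // (le_trans r0).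
  rewrite r2 gerDl => h; apply/eqP; rewrite -sqrf_eq0 eq_le h sqr_ge0 //.
by rewrite lecE /= i0 eqxx (le_trans r0).
Qed.

Lemma mx_col_ext m n (A B : 'M[C]_(m, n)) :
  (forall y : 'cV[C]_n, A *m y = B *m y) -> A = B.
Proof.
move=> AB; apply/matrixP => i j; have := congr1 (fun c : 'cV_m => c i 0) (AB (delta_mx j 0)).
by rewrite -!colE !mxE.
Qed.

(** The quadratic form of D = H^* - H vanishes; polarization with x + y and x + i y gives D = 0. *)
Lemma hermitian_of_ge0 n (H : 'M[C]_n) :
  (forall v : 'cV[C]_n, 0 <= ip v (H *m v)) -> H^t* = H.
Proof.
move=> H0; pose D := H^t* - H.
have D0 v : ip v (D *m v) = 0.
  rewrite mulmxBl ipDr ipNr; apply/eqP; rewrite subr_eq0; apply/eqP.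
  by rewrite -ip_adjr ip_conj conjc_ge0.
have D2 x y : ip x (D *m y) + ip y (D *m x) = 0.
  have := D0 (x + y); rewrite mulmxDr ipDl !ipDr !D0 add0r addr0 //.
have D3 x y : ip x (D *m y) = 0.
  have := D2 x ('i%C *: y); rewrite ipZl -scalemxAr ipZr.
  have -> : conjc 'i%C = - 'i%C :> C by rewrite /=; simpc.
  have := D2 x y; move/eqP; rewrite addrC addr_eq0 => /eqP ->.
  rewrite mulrNN -mulrDr => /eqP; rewrite mulf_eq0.
  have -> : ('i%C == 0 :> C) = false by rewrite eq_complex /= oner_eq0 andbF.
  by rewrite /= -mulr2n mulrn_eq0 => /eqP.
apply/eqP; rewrite -subr_eq0 -/D; apply/eqP; apply: mx_col_ext => y.
by rewrite mul0mx; apply: nsq_eq0; rewrite /nsq D3.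
Qed.

(** U multiplies v by z and fixes the orthogonal complement of v. *)
Lemma phase_unitary n (v : 'cV[C]_n) (z : C) : nsq v = 1 -> conjc z * z = 1 ->
  let U := 1%:M + (z - 1) *: (v *m v^t*) in U^t* *m U = 1%:M.
Proof.
move=> v1 z1 U; rewrite /U adjD adj1 adjZ adjM trmxCK mulmxDl mul1mx.
rewrite mulmxDr mulmx1 -addrA -scalemxAl -scalemxAr scalerA.
have -> : v *m v^t* *m (v *m v^t*) = v *m v^t*.
  by rewrite mulmxA rank1_mulmx ip_nsq v1 scale1r.
rewrite -!scalerDl; have -> : z - 1 + (conjc (z - 1) + conjc (z - 1) * (z - 1)) = 0.
  by rewrite rmorphB rmorph1 /= mulrBr mulr1 mulrBl mul1r z1; ring.
by rewrite scale0r addr0.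
Qed.

(** The hypothesis makes p f a subgradient at x0 of max(x^p - s^p, 0) on the half-line. This
    function has slope 0 below s and p x^(p-1) above s, with a kink at s. *)
Lemma threshold_slope (p f x0 s : R) : 2 <= p -> 0 <= f -> 0 <= x0 -> 0 <= s ->
  (forall x, 0 <= x -> p * (f * (x - x0)) <=
     Num.max (x `^ p - s `^ p) 0 - Num.max (x0 `^ p - s `^ p) 0) ->
  [/\ f <= x0 `^ (p - 1), x0 < s -> f = 0 & s < x0 -> f = x0 `^ (p - 1)].
Proof.
move=> p2 f0 x00 s0 h; have p0 : 0 <= p by lra.
have p0' : 0 < p by lra.
have p1 : 1 <= p by lra.
have p1' : 0 < p - 1 by lra.
have maxl x : s <= x -> Num.max (x `^ p - s `^ p) 0 = x `^ p - s `^ p.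
  by move=> sx; apply/max_idPl; rewrite subr_ge0 powR_le2.
have maxr x : 0 <= x -> x <= s -> Num.max (x `^ p - s `^ p) 0 = 0.
  by move=> x0' xs; apply/max_idPr; rewrite subr_le0 powR_le2.
(* The tangent at x, evaluated at x0, bounds x^p - x0^p by p x^(p-1) (x - x0). *)
have slope x : 0 <= x -> s <= x -> s <= x0 -> (f - x `^ (p - 1)) * (x - x0) <= 0.
  move=> x_ge0 sx sx0; have := h x x_ge0; rewrite !maxl // => hx.
  have := powR_tangent p1 x00 x_ge0; rewrite -(mulr_powRB1 x_ge0 p0') in hx *.
  move=> ht; rewrite -(pmulr_rle0 _ p0').
  move: hx ht; set a := x `^ (p - 1); set b := x0 `^ p; set c := s `^ p => hx ht.
  lra.
(* The point whose slope is p f. Comparing y with x0 through intermediate points replaces a limit x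
   -> x0. *)
pose y := f `^ (p - 1)^-1.
have y0 : 0 <= y by exact: powR_ge0.
have fy : f = y `^ (p - 1) by rewrite powR_invl // gt_eqF.
have y_le x : 0 <= x -> f <= x `^ (p - 1) -> y <= x.
  move=> x_ge0; rewrite fy !leNgt; apply: contraNN; exact: powR_lt2.
have y_ge x : 0 <= x -> x `^ (p - 1) <= f -> x <= y.
  move=> x_ge0; rewrite fy !leNgt; apply: contraNN; exact: powR_lt2.
have lt0f : x0 < s -> f = 0.
  move=> x0s; have := h s s0; rewrite (maxl s) // (maxr x0 x00 (ltW x0s)) subrr subr0.
  have d : 0 < p * (s - x0) by rewrite mulr_gt0 // subr_gt0.
  by rewrite mulrCA pmulr_lle0 // => f0'; apply/le_anti; rewrite f0 f0'.
have ub : f <= x0 `^ (p - 1).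
  have [x0s|sx0] := ltP x0 s; first by rewrite lt0f // powR_ge0.
  rewrite fy powR_le2 ?(ltW p1') // leNgt; apply/negP => x0y.
  pose x := (x0 + y) / 2.
  have x0x : x0 < x by rewrite /x; lra.
  have := slope x (le_trans x00 (ltW x0x)) (le_trans sx0 (ltW x0x)) sx0.
  rewrite pmulr_lle0 ?subr_gt0 // subr_le0 => /y_le.
  by move=> /(_ (le_trans x00 (ltW x0x))); rewrite /x; lra.
split=> // sx0; apply/le_anti; rewrite ub /=.
rewrite fy powR_le2 ?(ltW p1') // leNgt; apply/negP => yx0.
(* The maximum with s keeps the test point in the range of [slope]. *)
pose x := (Num.max s y + x0) / 2.
have mx0 : Num.max s y < x0 by rewrite gt_max sx0.
have xx0 : x < x0 by rewrite /x; lra.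
have [sm ym] : s <= Num.max s y /\ y <= Num.max s y by rewrite !le_max !lexx orbT.
have sx : s <= x by rewrite /x; lra.
have x_ge0 := le_trans s0 sx.
have := slope x x_ge0 sx (ltW sx0).
rewrite nmulr_lle0 ?subr_lt0 // subr_ge0 => /(y_ge x x_ge0); rewrite /x; lra.
Qed.

End Positivity.

(** * A common singular basis for A and a subgradient G *)

Section Subset.
Variables (R : realType) (m n k : nat) (p : R).
Local Notation C := R[i].
Variables (A G : 'M[C]_(m, n)).
Hypotheses (p_ge2 : 2 <= p) (k_gt0 : (0 < k)%N) (k_le_n : (k <= n)%N).
Hypothesis A_neq0 : A != 0.
Local Notation N := (kyfan p k).
Hypothesis subG : forall X, tip G (X - A) <= N X - N A.
Local Notation M := (A^t* *m A).

Let p_gt0 : 0 < p.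
Proof. by rewrite (lt_le_trans _ p_ge2). Qed.

Let p_ge1 : 1 <= p.
Proof. by rewrite (le_trans _ p_ge2) // ler1n. Qed.

Let subG0 X : N X <= N A -> tip G (X - A) <= 0.
Proof. by move=> XA; apply: (le_trans (subG X)); rewrite subr_le0. Qed.

Lemma ip_ge0_of_unit q (H : 'M[C]_q) :
  (forall v, nsq v = 1 -> 0 <= ip v (H *m v)) -> forall v, 0 <= ip v (H *m v).
Proof.
move=> H1 v; have [v0|v0] := eqVneq (nsq v) 0.
  by rewrite (nsq_eq0 v0) mulmx0 ip0r.
have vp : 0 < nsq v by rewrite lt_neqAle eq_sym v0 nsq_ge0.
pose r := Num.sqrt (nsq v); have r0 : 0 < r by rewrite sqrtr_gt0.
have vE : v = r%:C *: (r^-1%:C *: v).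
  by rewrite scalerA -rmorphM divff ?gt_eqF // rmorph1 scale1r.
rewrite vE -scalemxAr ipZl ipZr conjc_real !mulr_ge0 ?ler0c ?(ltW r0) //.
apply: H1; rewrite nsqZr exprVn sqr_sqrtr ?nsq_ge0 // mulVf //.
Qed.

(* Multiplying [A] by a unitary does not change its norm, so that the phases of
   [phase_unitary] satisfy the hypothesis of [ge0_of_phase]. *)
Lemma subgradient_mul_ge0 v : 0 <= ip v (G^t* *m A *m v).
Proof.
move: v; apply: ip_ge0_of_unit => v v1; apply: ge0_of_phase => z z1.
pose U := 1%:M + (z - 1) *: (v *m v^t*).
have UU : U^t* *m U = 1%:M by exact: phase_unitary.
have -> : (z - 1) * ip v (G^t* *m A *m v) = \tr (G^t* *m (A *m U - A)).
  rewrite /U mulmxDr mulmx1 [A + _]addrC addrK -!scalemxAr mxtraceZ.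
  by rewrite !mulmxA trace_rank1.
apply: subG0; apply: kyfan_le => // y oy; exists (fun i => U *m y i).
  by apply: orthonormalP => i j; rewrite ip_adjr mulmxA UU mul1mx ip_orthonormal.
by move=> i; rewrite mulmxA.
Qed.

(** The same phase test with the unitary on the left, where |U A y| = |A y| for each y. *)
Lemma mul_subgradient_ge0 v : 0 <= ip v (A *m G^t* *m v).
Proof.
move: v; apply: ip_ge0_of_unit => v v1; apply: ge0_of_phase => z z1.
pose U := 1%:M + (z - 1) *: (v *m v^t*).
have UU : U^t* *m U = 1%:M by exact: phase_unitary.
have -> : (z - 1) * ip v (A *m G^t* *m v) = \tr (G^t* *m (U *m A - A)).
  rewrite /U mulmxDl mul1mx [A + _]addrC addrK -!scalemxAl -!scalemxAr mxtraceZ.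
  by rewrite mulmxA mxtrace_mulC !mulmxA trace_rank1.
apply: subG0; apply: kyfan_le => // y oy; exists y => // i.
by rewrite /nsq -mulmxA ip_adjr [U^t* *m _]mulmxA UU mul1mx.
Qed.

Let GA : A^t* *m G = G^t* *m A.
Proof. by rewrite -(hermitian_of_ge0 subgradient_mul_ge0) adjM trmxCK. Qed.

Let AG : G *m A^t* = A *m G^t*.
Proof. by rewrite -(hermitian_of_ge0 mul_subgradient_ge0) adjM trmxCK. Qed.

(* As [G^* A] and [A G^*] are Hermitian, [G^* A] commutes with [A^* A].  The
   second alternative covers [A v_j = G v_j = 0], with [w_j = 0]. *)
Lemma subgradient_basis : exists v : 'I_n -> 'cV[C]_n, exists w : 'I_n -> 'cV[C]_m,
  exists g : 'I_n -> R, [/\ orthonormal_fam v,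
    forall j : 'I_n, M *m v j = (singval A j ^+ 2)%:C *: v j &
    forall j : 'I_n, [/\ 0 <= g j, A *m v j = (singval A j)%:C *: w j,
      G *m v j = (g j)%:C *: w j, A^t* *m w j = (singval A j)%:C *: v j &
      nsq (w j) = 1 \/ g j = 0 /\ singval A j = 0]].
Proof.
have HM : G^t* *m A *m M = M *m (G^t* *m A).
  by rewrite -{1}GA -[A^t* *m G *m _]mulmxA [G *m _]mulmxA AG !mulmxA.
have [v [h [ov Av Hv]]] := singval_eigenbasis (hermitian_of_ge0 subgradient_mul_ge0) HM.
have h0 j : 0 <= h j.
  have := subgradient_mul_ge0 (v j).
  by rewrite Hv ipZr ip_nsq nsq_orthonormal // mulr1 ler0c.
suff : forall j, exists wg : 'cV[C]_m * R, [/\ 0 <= wg.2, A *m v j = (singval A j)%:C *: wg.1,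
      G *m v j = (wg.2)%:C *: wg.1, A^t* *m wg.1 = (singval A j)%:C *: v j &
      nsq wg.1 = 1 \/ wg.2 = 0 /\ singval A j = 0].
  move=> /boolp.choice[wg hwg]; exists v, (fun j => (wg j).1), (fun j => (wg j).2).
  by split.
move=> j; set s := singval A j.
have sE : s ^+ 2 = nsq (A *m v j).
  exact: (gram_eigenvalue (nsq_orthonormal j ov) (Av j)).
have s0 : 0 <= s by exact: singval_ge0.
have [s_eq0|s_neq0] := eqVneq s 0; last first.
  have sC : s%:C != 0 :> C by rewrite eq_complex /= eqxx andbT.
  (* Since G M = A G^* A, applying both to v_j gives s^2 G v_j = h_j A v_j, hence g_j = h_j / s. *)
  exists (s^-1%:C *: (A *m v j), h j / s); split => /=.
  - by rewrite divr_ge0.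
  - by rewrite scalerA -rmorphM divff // rmorph1 scale1r.
  - have s2C : (s ^+ 2)%:C != 0 :> C by rewrite rmorphXn expf_neq0.
    have GM : G *m M = A *m (G^t* *m A) by rewrite mulmxA AG mulmxA.
    apply: (scalerI s2C); rewrite scalemxAr -Av mulmxA GM -mulmxA Hv -scalemxAr.
    rewrite !scalerA -!rmorphM; congr (_%:C *: _).
    by rewrite mulrC -[_ / s / s]mulrA -invfM -expr2 divfK // expf_neq0.
  - rewrite -scalemxAr mulmxA Av scalerA -rmorphM; congr (_%:C *: _).
    by rewrite expr2 mulKf.
  - by left; rewrite nsqZr -sE exprVn mulVf // expf_neq0.
have Av0 : A *m v j = 0 by apply: nsq_eq0; rewrite -sE s_eq0 expr0n.
have [u0|u0] := eqVneq (G *m v j) 0.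
  by exists (0, 0); split => //=; rewrite ?Av0 ?u0 ?mulmx0 ?s_eq0 ?scaler0 ?scale0r //; right.
(* With A v_j = 0, w_j is the normalized G v_j; then A^* w_j = 0 because A^* G v_j = G^* A v_j. *)
pose r := Num.sqrt (nsq (G *m v j)).
have r2 : r ^+ 2 = nsq (G *m v j) := sqr_sqrtr (nsq_ge0 _).
have r0 : r != 0.
  by apply: contra_neq u0 => r_eq0; apply: nsq_eq0; rewrite -r2 r_eq0 expr0n.
exists (r^-1%:C *: (G *m v j), r); split => /=.
- exact: sqrtr_ge0.
- by rewrite Av0 s_eq0 scale0r.
- by rewrite scalerA -rmorphM divff // rmorph1 scale1r.
- by rewrite -scalemxAr mulmxA GA -mulmxA Av0 mulmx0 scaler0 s_eq0 scale0r.
- by left; rewrite nsqZr -r2 exprVn mulVf // expf_neq0.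
Qed.

(** * Size of the coefficients of a subgradient *)

Section Coefficients.
Variables (v : 'I_n -> 'cV[C]_n) (w : 'I_n -> 'cV[C]_m) (g : 'I_n -> R).
Hypotheses (ov : orthonormal_fam v)
  (Av : forall j : 'I_n, M *m v j = (singval A j ^+ 2)%:C *: v j)
  (hw : forall j : 'I_n, [/\ 0 <= g j, A *m v j = (singval A j)%:C *: w j,
      G *m v j = (g j)%:C *: w j, A^t* *m w j = (singval A j)%:C *: v j &
      nsq (w j) = 1 \/ g j = 0 /\ singval A j = 0]).
Local Notation s := (singval A k.-1).

(** Scaling A multiplies each term of the threshold sum by c^p, if the threshold is scaled too. *)
Lemma kyfan_scale (c : R) : 0 <= c -> N (c%:C *: A) <= c * N A.
Proof.
move=> c0; have cN0 : 0 <= c * N A by rewrite mulr_ge0 ?kyfan_ge0.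
rewrite leNgt; apply/negP => /(powR_lt2 p_gt0 cN0); apply/negP; rewrite -leNgt.
rewrite [leRHS](powRM p c0 (kyfan_ge0 k p A)).
rewrite -[X in _ <= _ * X](sum_threshold p_ge2 k_gt0 k_le_n A).
pose d (j : 'I_n) := c ^+ 2 * singval A j ^+ 2.
have Xv j : (c%:C *: A)^t* *m (c%:C *: A) *m v j = (d j)%:C *: v j.
  rewrite adjZr -!scalemxAl -scalemxAr -scalemxAl Av !scalerA -!rmorphM.
  by congr (_%:C *: _); rewrite /d; ring.
apply: le_trans (kyfan_le_threshold p_ge2 k_le_n (c `^ p * s `^ p) ov Xv) _.
rewrite mulrDr [k%:R * _]mulrCA lerD2r mulr_sumr; apply: ler_sum => j _.
have -> : d j `^ (p / 2) = c `^ p * singval A j `^ p.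
  rewrite /d -exprMn powR_sqr ?mulr_ge0 ?singval_ge0 //.
  by rewrite mulrCA divff ?mulr1 ?pnatr_eq0 // powRM ?singval_ge0.
by rewrite -mulrBr maxr_pMr ?powR_ge0 // mulr0.
Qed.

(** Subgradient inequality at 2 A for one bound and at 0 for the other. *)
Lemma tip_subgradient : tip G A = N A.
Proof.
apply/le_anti/andP; split.
  have two0 : (0 : R) <= 2 by [].
  have := subG (2%:C *: A); have := kyfan_scale two0.
  rewrite tipDr tipNr tipZr.
  by move: (N (_ *: A)) (N A) (tip G A) => a b c; lra.
have := subG (0%:C *: A); have := kyfan_scale (lexx 0).
rewrite tipDr tipNr tipZr.
by move: (N (_ *: A)) (N A) (tip G A) => a b c; lra.
Qed.

Lemma sum_coefficients : \sum_(j < n) g j * singval A j = N A.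
Proof.
rewrite -tip_subgradient /tip (mxtrace_onb _ ov) Re_sum; apply: eq_bigr => j _.
have [g0 Avj Gvj _ w1] := hw j.
rewrite -mulmxA -ip_adjr Gvj Avj ipZl ipZr conjc_real !ReM -/(nsq _).
by case: w1 => [->|[-> ->]]; rewrite ?mulr1 // !mul0r.
Qed.

(* Test of the subgradient inequality on [A + (x - sigma_j) w_j v_j^*]: its Gram
   matrix has the eigenbasis [v], and only the [j]-th eigenvalue has changed. *)
Lemma coefficient_slope j x : nsq (w j) = 1 -> 0 <= x ->
  p * (N A `^ (p - 1) * g j * (x - singval A j)) <=
  Num.max (x `^ p - s `^ p) 0 - Num.max (singval A j `^ p - s `^ p) 0.
Proof.
move=> w1 x0; have [g0 Avj Gvj Awj _] := hw j; set sj := singval A j.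
pose X := A + (x - sj)%:C *: (w j *m (v j)^t*).
have tX : tip G (X - A) = g j * (x - sj).
  rewrite /X [A + _]addrC addrK tipZr.
  have -> : tip G (w j *m (v j)^t*) = g j.
    rewrite /tip mulmxA trace_rank1 -ip_adjr Gvj ipZl conjc_real ReM -/(nsq _).
    by rewrite w1 mulr1.
  by rewrite mulrC.
pose d (i : 'I_n) := if i == j then x ^+ 2 else singval A i ^+ 2.
have Xv i : X^t* *m X *m v i = (d i)%:C *: v i.
  have wX : (w j)^t* *m A = sj%:C *: (v j)^t*.
    by rewrite -[A]trmxCK -adjM Awj adjZr.
  have -> : X^t* *m X = M + (x ^+ 2 - sj ^+ 2)%:C *: (v j *m (v j)^t*).
    rewrite /X adjD adjZr adjM trmxCK mulmxDl !mulmxDr -addrA; congr (_ + _).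
    rewrite -!scalemxAl -!scalemxAr !mulmxA Awj -mulmxA wX.
    rewrite -[v j *m (w j)^t* *m w j]mulmxA ipE ip_nsq w1 mulmx1.
    rewrite -scalemxAr -scalemxAl !scalerA -!scalerDl -!rmorphM -!rmorphD.
    by congr (_%:C *: _); rewrite /sj; ring.
  rewrite mulmxDl Av -scalemxAl rank1_mulmx ip_orthonormal // /d eq_sym.
  case: eqP => [->|_]; last by rewrite scale0r scaler0 addr0.
  by rewrite scale1r -scalerDl -rmorphD; congr (_%:C *: _); rewrite addrC subrK.
have N0 : 0 < N A by exact: kyfan_gt0.
(* [h1] and [h4] give p N(A)^(p-1) (N(X) - N(A)) <= N(X)^p - N(A)^p. Then [h2] bounds N(X)^p with
   the threshold of A, for which [h3] is exact, so all terms but the j-th cancel. *)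
have h1 := powR_tangent p_ge1 (kyfan_ge0 k p X) (ltW N0).
have h2 := kyfan_le_threshold p_ge2 k_le_n (s `^ p) ov Xv.
have h3 := sum_threshold p_ge2 k_gt0 k_le_n A.
have h4 := congr1 ( *%R p) (mulr_powRB1 (ltW N0) p_gt0).
have h5 := ler_wpM2l (powR_ge0 (N A) (p - 1)) (subG X); rewrite tX in h5.
have {}h5 := ler_wpM2l (ltW p_gt0) h5.
rewrite (bigD1 j) //= in h3; rewrite (bigD1 j) //= in h2.
move: h2; have -> : \sum_(i < n | i != j) Num.max (d i `^ (p / 2) - s `^ p) 0 =
    \sum_(i < n | i != j) Num.max (singval A i `^ p - s `^ p) 0.
  apply: eq_bigr => i /negPf ij; rewrite /d ij powR_sqr ?singval_ge0 //.
  by rewrite mulrCA divff ?mulr1 ?pnatr_eq0.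
have -> : d j `^ (p / 2) = x `^ p.
  by rewrite /d eqxx powR_sqr // mulrCA divff ?mulr1 ?pnatr_eq0.
move: h1 h3 h4 h5; rewrite /sj.
move: (N A) (N X) (Num.max _ _) (Num.max _ _) (\sum_(_ < _ | _) _) => a b c e f.
move: (a `^ (p - 1)) (a `^ p) (b `^ p) (s `^ p) (singval A j) => a1 ap bp sp sj'.
lra.
Qed.

Lemma coefficient_bounds j (f := N A `^ (p - 1) * g j) :
  [/\ 0 <= f, f <= singval A j `^ (p - 1), singval A j < s -> f = 0 &
      s < singval A j -> f = singval A j `^ (p - 1)].
Proof.
have [g0 _ _ _ w1] := hw j.
have f0 : 0 <= f by rewrite mulr_ge0 ?powR_ge0.
case: w1 => [w1|[g_eq0 s_eq0]].
  have [|||h1 h2 h3] := @threshold_slope R p f (singval A j) s p_ge2 f0.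
  - exact: singval_ge0.
  - exact: singval_ge0.
  - by move=> x x0; exact: coefficient_slope.
  by split.
have -> : f = 0 by rewrite /f g_eq0 mulr0.
split=> //; first exact: powR_ge0.
by rewrite s_eq0 ltNge singval_ge0.
Qed.

End Coefficients.
End Subset.

(** * Points of a hypersimplex as convex combinations of its vertices *)

Section Hypersimplex.
Variable R : realType.
Local Notation C := R[i].

Lemma convex_comb (V : lmodType C) (S : set V) (x y : V) (r : R) :
  @convex_set _ V S -> S x -> S y -> 0 <= r <= 1 ->
  S (r%:C *: x + (1 - r)%:C *: y).
Proof.
move=> cS Sx Sy /andP[r0 r1].
have r0C : 0 <= r%:C :> C by rewrite ler0c.
have r1C : r%:C <= 1 :> C by rewrite -(rmorph1 (real_complex R)) lecR.
have /set_mem := cS x y (Itv01 r0C r1C) (mem_set Sx) (mem_set Sy).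
by rewrite convex_lmodE /= rmorphB rmorph1.
Qed.

Section Walk.
Variables (n : nat) (t : 'I_n -> R) (a b : 'I_n).
Hypotheses (ab : a != b) (t01 : forall j, 0 <= t j <= 1).
(** The largest amount that can pass from coordinate b to coordinate a while both stay in [0, 1]. *)
Let d := Num.min (1 - t a) (t b).

Definition walk (j : 'I_n) : R :=
  if j == a then t a + d else if j == b then t b - d else t j.

Let ba : (b == a) = false.
Proof. by rewrite eq_sym (negPf ab). Qed.

Lemma walk_bounds j : 0 <= walk j <= 1.
Proof.
have [[d1 d2] d0] : (d <= 1 - t a /\ d <= t b) /\ 0 <= d.
  have /andP[a0 a1] := t01 a; have /andP[b0 b1] := t01 b.
  by rewrite /d ge_min lexx ge_min lexx orbT le_min subr_ge0 a1 b0.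
have /andP[a0 a1] := t01 a; have /andP[b0 b1] := t01 b; rewrite /walk.
case: eqP => _; first by apply/andP; split; lra.
case: eqP => _; first by apply/andP; split; lra.
exact: t01.
Qed.

Lemma walk_sum (V : lmodType C) (E : 'I_n -> V) :
  \sum_j (walk j)%:C *: E j = \sum_j (t j)%:C *: E j + d%:C *: (E a - E b).
Proof.
rewrite (bigD1 a) // (bigD1 b) /=; last by rewrite ba.
rewrite [in RHS](bigD1 a) //= [in RHS](bigD1 b) /=; last by rewrite ba.
rewrite {1 2}/walk eqxx ba eqxx rmorphD rmorphB /= scalerDl scalerBl scalerBr.
have -> : \sum_(i < n | (i != a) && (i != b)) (walk i)%:C *: E i =
    \sum_(i < n | (i != a) && (i != b)) (t i)%:C *: E i.
  by apply: eq_bigr => i /andP[/negPf ia /negPf ib]; rewrite /walk ia ib.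
set s := \sum_(_ < n | _) _; rewrite -!addrA; congr (_ + _).
by rewrite addrCA; congr (_ + _); rewrite addrA addrC.
Qed.

Lemma walk_sumr : \sum_j walk j = \sum_j t j.
Proof.
rewrite (bigD1 a) // (bigD1 b) /=; last by rewrite ba.
rewrite [in RHS](bigD1 a) //= [in RHS](bigD1 b) /=; last by rewrite ba.
rewrite {1 2}/walk eqxx ba eqxx.
have -> : \sum_(i < n | (i != a) && (i != b)) walk i =
    \sum_(i < n | (i != a) && (i != b)) t i.
  by apply: eq_bigr => i /andP[/negPf ia /negPf ib]; rewrite /walk ia ib.
by ring.
Qed.

Definition fractional (u : 'I_n -> R) := [set j | (u j != 0) && (u j != 1)]%SET.

(** By the choice of [d], either a arrives at 1 or b at 0, and the other coordinates stay as they
    are. *)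
Lemma walk_fractional : a \in fractional t -> b \in fractional t ->
  (#|fractional walk| < #|fractional t|)%N.
Proof.
move=> fa fb; apply: proper_card; apply/properP; split.
  apply/fintype.subsetP => j; have [->|ja] := eqVneq j a; first by [].
  have [->|jb] := eqVneq j b; first by [].
  by rewrite !inE /walk (negPf ja) (negPf jb).
have [h|h] := leP (1 - t a) (t b).
  exists a => //; rewrite inE /walk eqxx /d (min_idPl h) addrC subrK eqxx.
  by rewrite andbF.
exists b => //; rewrite inE /walk ba eqxx /d (min_idPr (ltW h)) subrr eqxx //.
Qed.

Lemma walk_gt0 : a \in fractional t -> b \in fractional t -> 0 < d.
Proof.
rewrite !inE => /andP[_ a1] /andP[b0 _].
have /andP[_ a1'] := t01 a; have /andP[b0' _] := t01 b.
by rewrite lt_min subr_gt0 !lt_neqAle a1 a1' eq_sym b0 b0'.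
Qed.

End Walk.

(* Along [E a - E b], with [t a] and [t b] fractional, the point [t] lies between
   the two points where one more coordinate has become [0] or [1]. *)
Lemma hypersimplex_hull n k (V : lmodType C) (S : set V) (E : 'I_n -> V)
    (P Q : pred 'I_n) :
  @convex_set _ V S ->
  (forall J : {set 'I_n}, #|J| = k -> (forall j, P j -> j \in J) ->
     (forall j, j \in J -> Q j) -> S (\sum_(j in J) E j)) ->
  forall t : 'I_n -> R, (forall j, 0 <= t j <= 1) -> \sum_j t j = k%:R ->
    (forall j, P j -> t j = 1) -> (forall j, ~~ Q j -> t j = 0) ->
    S (\sum_j (t j)%:C *: E j).
Proof.
move=> cS vS t; have [N] := ubnP #|fractional t|.
elim: N t => // N IH t ltN t01 sumt tP tQ.
have [f0|[a fa]] := set_0Vmem (fractional t).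
  pose J := [set j | t j == 1]%SET.
  have tE j : t j = (j \in J)%:R.
    have : j \notin fractional t by rewrite f0 inE.
    rewrite !inE negb_and !negbK => /orP[/eqP ->|/eqP ->]; last by rewrite eqxx.
    by rewrite eq_sym oner_eq0.
  have -> : \sum_j (t j)%:C *: E j = \sum_(j in J) E j.
    rewrite [RHS]big_mkcond /=; apply: eq_bigr => j _; rewrite tE.
    by case: (j \in J); rewrite ?rmorph1 ?rmorph0 ?scale1r ?scale0r.
  apply: vS.
  - apply/eqP; rewrite -(eqr_nat R) -sumt -sumr_const [\sum_(i in J) _]big_mkcond /=.
    by apply/eqP/eq_bigr => j _; rewrite tE; case: (j \in J).
  - by move=> j /tP tj; rewrite inE tj.
  - move=> j; rewrite inE; apply: contraLR => /tQ ->.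
    by rewrite eq_sym oner_eq0.
(* A single fractional coordinate is impossible: it would equal k - |J|, an integer strictly between
   0 and 1. *)
have [b fb ab] : exists2 b, b \in fractional t & a != b.
  apply/exists_inP; apply: contraT; rewrite negb_exists_in => /forall_inP h.
  pose J := [set j | t j == 1]%SET.
  have tE j : j != a -> t j = (j \in J)%:R.
    move=> ja; have : j \notin fractional t.
      by apply: contraNN ja => /h; rewrite negbK eq_sym.
    rewrite !inE negb_and !negbK => /orP[/eqP ->|/eqP ->]; last by rewrite eqxx.
    by rewrite eq_sym oner_eq0.
  have aJ : a \notin J by move: fa; rewrite !inE => /andP[].
  have ta : t a = k%:R - #|J|%:R.
    rewrite -sumt (bigD1 a) //= (eq_bigr (fun j => (j \in J)%:R)) //.
    rewrite -sumr_const [\sum_(i in J) _]big_mkcond /= [X in _ - X](bigD1 a) //=.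
    rewrite (negPf aJ) add0r.
    have -> : \sum_(i < n | i != a) (if i \in J then 1 else 0 : R) =
       \sum_(i < n | i != a) (i \in J)%:R.
      by apply: eq_bigr => i _; case: (i \in J).
    by rewrite addrK.
  have /andP[a0 a1] := t01 a.
  move: fa; rewrite inE => /andP[an0 an1].
  have a0' : 0 < t a by rewrite lt_neqAle eq_sym an0.
  have a1' : t a < 1 by rewrite lt_neqAle an1.
  move: a0' a1'; rewrite ta subr_gt0 ltr_nat ltrBlDl natr1 ltr_nat.
  by rewrite leqNgt => /negPf ->.
have fP j : j \in fractional t -> ~~ P j.
  by rewrite inE => /andP[_]; apply: contraNN => /tP ->.
have fQ j : j \in fractional t -> Q j.
  by rewrite inE => /andP[+ _]; apply: contraR => /tQ ->.
have step c d : c \in fractional t -> d \in fractional t -> c != d ->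
    S (\sum_j (walk t c d j)%:C *: E j).
  move=> fc fd cd; apply: IH.
  - exact: leq_trans (walk_fractional cd fc fd) ltN.
  - exact: walk_bounds.
  - by rewrite walk_sumr.
  - move=> j Pj; rewrite /walk.
    case: eqP => [jc|_]; first by move: (fP c fc); rewrite -jc Pj.
    case: eqP => [jd|_]; first by move: (fP d fd); rewrite -jd Pj.
    exact: tP.
  - move=> j Qj; rewrite /walk.
    case: eqP => [jc|_]; first by move: Qj; rewrite jc fQ.
    case: eqP => [jd|_]; first by move: Qj; rewrite jd fQ.
    exact: tQ.
have ba : b != a by rewrite eq_sym.
have := walk_gt0 t01 fa fb; have := walk_gt0 t01 fb fa.
have := step _ _ fa fb ab; have := step _ _ fb fa ba; rewrite !walk_sum //.
rewrite -(opprB (E a) (E b)); set u := E a - E b.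
set d1 := Num.min (1 - t a) (t b); set d2 := Num.min (1 - t b) (t a).
set F := \sum_j _ => S2 S1 d2_gt0 d1_gt0.
have dd : d1 + d2 != 0 by rewrite gt_eqF // addr_gt0.
(* These weights make the displacements d1 u and -d2 u cancel. *)
have r01 : 0 <= d2 / (d1 + d2) <= 1.
  by rewrite divr_ge0 ?addr_ge0 ?ler_pdivrMr ?mul1r ?lerDr ?addr_gt0 ?ltW.
have := convex_comb cS S1 S2 r01.
have -> : 1 - d2 / (d1 + d2) = d1 / (d1 + d2) by field.
clearbody u; rewrite !scalerDr addrACA -scalerDl -rmorphD -mulrDl [d2 + _]addrC divff //.
rewrite rmorph1 scale1r !scalerA -!rmorphM scalerN -scalerBl -rmorphB.
have -> : d2 / (d1 + d2) * d1 - d1 / (d1 + d2) * d2 = 0 by ring.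
by rewrite rmorph0 scale0r addr0.
Qed.

End Hypersimplex.

(** * Increasing enumeration of a finite set of indices *)

Section Enumeration.
Variables (n k : nat) (J : {set 'I_n}).
Hypothesis cardJ : #|J| = k.

Lemma increasing_enum : exists e : 'I_k -> 'I_n, [/\ injective e,
  forall i : 'I_k, (i <= e i)%N, forall j, j \in J -> exists i, e i = j &
  forall (V : nmodType) (F : 'I_n -> V), \sum_(j in J) F j = \sum_i F (e i)] /\
  forall i, e i \in J.
Proof.
have sJ : size (enum J) = k by rewrite -cardE.
(* [nth] needs a default index; if there is none, then k = 0 and [e] has empty domain. *)
have [j0 _|n0] := pickP (@predT 'I_n); last first.
  have k0 : k = 0%N by rewrite -cardJ; apply: eq_card0 => j; have := n0 j.
  have no (i : 'I_k) : False by case: i => i; rewrite k0.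
  exists (fun i => False_rect _ (no i)); split; last by move=> i; case: (no i).
  split; try by move=> i; case: (no i).
    by move=> j; have := n0 j.
  move=> V F; rewrite big1 => [|j _]; last by have := n0 j.
  by rewrite big1 // => i; case: (no i).
pose e (i : 'I_k) := nth j0 (enum J) i.
have lt_sJ (i : 'I_k) : (i < size (enum J))%N by rewrite sJ.
have srt : sorted ltn (map val (enum J)).
  have -> : enum J = [seq x <- enum 'I_n | x \in J] by rewrite enumT.
  rewrite sorted_map; apply: sorted_filter => [x y z|]; first exact: ltn_trans.
  by rewrite -sorted_map val_enum_ord iota_ltn_sorted.
(* A strictly increasing sequence of naturals is at least its index. *)
have ge_idx (i : nat) : (i < k)%N -> (i <= nth j0 (enum J) i)%N.
  elim: i => // i IH ik; apply: leq_ltn_trans (IH (ltnW ik)) _.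
  have := sorted_ltn_nth ltn_trans 0%N srt i i.+1.
  rewrite !inE size_map sJ (ltnW ik) ik => /(_ isT isT (ltnSn i)).
  by rewrite !(nth_map j0) ?sJ ?(ltnW ik).
exists e; split; last by move=> i; rewrite -mem_enum mem_nth.
split.
- move=> i i' /eqP; rewrite /e nth_uniq ?enum_uniq // => /eqP; exact: val_inj.
- by move=> i; exact: ge_idx.
- move=> j jJ; have jE : j \in enum J by rewrite mem_enum.
  have jk : (index j (enum J) < k)%N by rewrite -sJ index_mem.
  by exists (Ordinal jk); rewrite /e /= nth_index.
- move=> V F; rewrite -big_enum /= (big_nth j0) sJ big_mkord.
  by apply: eq_bigr.
Qed.

End Enumeration.

(** * Decomposition of a subgradient *)

Section Main.
Variables (R : realType) (m n k : nat) (p : R).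
Local Notation C := R[i].
Variable A : 'M[C]_(m, n).
Hypotheses (p_ge2 : 2 <= p) (k_gt0 : (0 < k)%N) (k_le_n : (k <= n)%N).
Hypothesis A_neq0 : A != 0.
Local Notation N := (kyfan p k).
Local Notation M := (A^t* *m A).
Local Notation s := (singval A k.-1).

Let p_gt0 : 0 < p.
Proof. by rewrite (lt_le_trans _ p_ge2). Qed.

Let p1_gt0 : 0 < p - 1.
Proof. by rewrite subr_gt0 (lt_le_trans _ p_ge2) // ltr1n. Qed.

(** Listing J increasingly preserves the singular values. If sigma_i > s, all indices up to i lie in
    J and e i = i. Otherwise sigma_i <= s <= sigma_(e i) <= sigma_i, the last because e i >= i. *)
Lemma face_of_set (v : 'I_n -> 'cV[C]_n) (J : {set 'I_n}) :
  orthonormal_fam v ->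
  (forall j : 'I_n, M *m v j = (singval A j ^+ 2)%:C *: v j) ->
  #|J| = k -> (forall j : 'I_n, s < singval A j -> j \in J) ->
  (forall j : 'I_n, j \in J -> s <= singval A j) ->
  exists u : 'I_k -> 'cV[C]_n, [/\ orthonormal_fam u,
    forall i : 'I_k, M *m u i = (singval A i ^+ 2)%:C *: u i &
    \sum_(j in J) v j *m (v j)^t* = \sum_i u i *m (u i)^t*].
Proof.
move=> ov Av cardJ ltJ Jge.
have [e [[inj_e le_e eJ sum_e] e_in]] := increasing_enum cardJ.
have e_id (i : 'I_k) : s < singval A i -> forall l : 'I_k, (l <= i)%N -> e l = l :> nat.
  move=> si l; have [N] := ubnP (l : nat); elim: N l => // N IH l ltN li.
  have ln : (l < n)%N by apply: leq_trans k_le_n.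
  (* The index l is in J, so it is e l' with l' <= l; if l' < l, induction would give e l' = l'. *)
  have [|l' el'] := eJ (Ordinal ln).
    by apply: ltJ; apply: lt_le_trans si _; exact: singval_le.
  have l'l : (l' <= l)%N by have := le_e l'; rewrite el'.
  move: l'l; rewrite leq_eqVlt => /orP[/eqP/val_inj ll'|l'l].
    by rewrite -{1}ll' el'.
  have := IH l' (leq_trans l'l ltN) (leq_trans (ltnW l'l) li).
  by rewrite el' /= => ll'; move: l'l; rewrite ll' ltnn.
have se (i : 'I_k) : singval A (e i) = singval A i.
  have [si|si] := ltP s (singval A i); first by rewrite (e_id i si i).
  apply/le_anti/andP; split; first by apply: singval_le; exact: le_e.
  by apply: le_trans si (Jge _ (e_in i)).
exists (v \o e); split => [|i|]; last exact: sum_e.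
  exact: orthonormal_comp.
by rewrite /= Av se.
Qed.

(** S stands for any convex set containing the generators; the hull is the intersection of these. *)
Lemma subgradient_in_hull G (S : set 'M[C]_(m, n)) :
  (forall X, tip G (X - A) <= N X - N A) ->
  @convex_set _ 'M[C]_(m, n) S ->
  (forall v : 'I_k -> 'cV[C]_n, orthonormal_fam v ->
    (forall i : 'I_k, M *m v i = (singval A i ^+ 2)%:C *: v i) ->
    S (kyfan_face p A v)) -> S G.
Proof.
move=> subG cS faceS.
have [v [w [g [ov Av hw]]]] := subgradient_basis p_ge2 k_gt0 k_le_n subG.
have fb := coefficient_bounds p_ge2 k_gt0 k_le_n A_neq0 subG ov Av hw.
have sumg := sum_coefficients p_ge2 k_gt0 k_le_n subG ov Av hw.
have N0 : 0 < N A by exact: kyfan_gt0.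
have N1 : 0 < N A `^ (p - 1) by exact: powR_gt0.
have sumf : \sum_j (N A `^ (p - 1) * g j) * singval A j = N A `^ p.
  rewrite -(mulr_powRB1 (ltW N0) p_gt0) mulrC -sumg mulr_sumr.
  by apply: eq_bigr => j _; rewrite mulrA.
have sumT := sum_threshold p_ge2 k_gt0 k_le_n A.
pose f j := N A `^ (p - 1) * g j.
have gE j : g j = (N A `^ (p - 1))^-1 * f j by rewrite /f mulKf // gt_eqF.
have {}fb j : [/\ 0 <= f j, f j <= singval A j `^ (p - 1),
  singval A j < s -> f j = 0 & s < singval A j -> f j = singval A j `^ (p - 1)].
  exact: fb.
have {}sumf : \sum_j f j * singval A j =
    \sum_(j < n) Num.max (singval A j `^ p - s `^ p) 0 + k%:R * s `^ p.
  by rewrite sumT.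
clearbody f; clear sumg sumT.
have s_ge0 i : 0 <= singval A i by exact: singval_ge0.
have [t [t01 tf sumt tP tQ]] : exists t : 'I_n -> R, [/\
    forall j, 0 <= t j <= 1, forall j, f j = t j * singval A j `^ (p - 1),
    \sum_j t j = k%:R, forall j : 'I_n, s < singval A j -> t j = 1 &
    forall j : 'I_n, ~~ (s <= singval A j) -> t j = 0].
  (* If s = 0, f does not determine t where sigma_j = 0. As sigma_j = 0 from index k on, the
     indicator of the first k indices fits. *)
  have [s_eq0|s_neq0] := eqVneq s 0.
    have ge_k (j : 'I_n) : (k <= j)%N -> singval A j = 0.
      move=> kj; apply/le_anti; rewrite s_ge0 andbT -s_eq0.
      by apply: singval_le; apply: leq_trans kj; exact: leq_pred.
    exists (fun j => (j < k)%N%:R); split.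
    - by move=> j; case: (_ < _)%N; rewrite ?lexx ?ler01.
    - move=> j; have [f0 f1 _ f2] := fb j.
      have [jk|/ge_k sj] := ltnP j k; last first.
        rewrite mul0r; apply/le_anti; rewrite f0 andbT.
        by move: f1; rewrite sj powR0 // gt_eqF.
      rewrite mul1r; have [sj|sj] := eqVneq (singval A j) 0.
        by apply/le_anti; rewrite f1 /= sj powR0 // gt_eqF.
      by apply: f2; rewrite s_eq0 lt_neqAle eq_sym sj s_ge0.
    - transitivity (\sum_(j < n | (j < k)%N) (1 : R)).
        by rewrite [RHS]big_mkcond; apply: eq_bigr => j _; case: (_ < _)%N.
      by rewrite -(big_ord_widen n (fun=> 1 : R) k_le_n) sumr_const card_ord.
    - move=> j; rewrite s_eq0; have [//|/ge_k ->] := ltnP j k.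
      by rewrite ltxx.
    - by move=> j; rewrite s_eq0 s_ge0.
  have s_gt0 : 0 < s by rewrite lt_neqAle eq_sym s_neq0 s_ge0.
  (* Where sigma_j = 0, the bound on f gives f = 0 and the quotient is 0 by convention. *)
  pose t j := f j / singval A j `^ (p - 1).
  have tP (j : 'I_n) : s < singval A j -> t j = 1.
    move=> sj; have [_ _ _ h] := fb j; rewrite /t h // divff // gt_eqF //.
    by rewrite powR_gt0 // (lt_trans s_gt0).
  have tQ (j : 'I_n) : singval A j < s -> t j = 0.
    by move=> sj; have [_ _ h _] := fb j; rewrite /t h // mul0r.
  have tf j : f j = t j * singval A j `^ (p - 1).
    have [f0 f1 _ _] := fb j; have [z|z] := eqVneq (singval A j `^ (p - 1)) 0.
      by rewrite z mulr0; apply/le_anti; rewrite f0 andbT -[leRHS]z.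
    by rewrite /t divfK.
  exists t; split => //.
  - move=> j; have [f0 f1 _ _] := fb j; rewrite /t divr_ge0 ?powR_ge0 //=.
    have [z|z] := eqVneq (singval A j `^ (p - 1)) 0.
      by rewrite z invr0 mulr0 ler01.
    by rewrite ler_pdivrMr ?mul1r // lt_neqAle eq_sym z powR_ge0.
  (* By the three cases of sigma_j against s, t_j sigma_j^p is the positive part of sigma_j^p - s^p
     plus t_j s^p. Comparing with [sumf] and cancelling s^p gives the sum k. *)
  - have sp : s `^ p != 0 by rewrite gt_eqF // powR_gt0.
    apply: (mulIf sp); apply: (addrI (\sum_(j < n) Num.max (singval A j `^ p - s `^ p) 0)).
    rewrite -sumf mulr_suml -big_split /=; apply: eq_bigr => j _.
    rewrite tf -mulrA [_ `^ (p - 1) * _]mulrC (mulr_powRB1 (s_ge0 j) p_gt0).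
    case: (ltgtP s (singval A j)) => sj.
    + rewrite tP // !mul1r (max_idPl _) ?subrK // subr_ge0.
      by rewrite powR_le2 ?(ltW p_gt0) ?s_ge0 // ltW.
    + rewrite tQ // !mul0r addr0; apply/max_idPr; rewrite subr_le0.
      by rewrite powR_le2 ?(ltW p_gt0) ?s_ge0 // ltW.
    + by rewrite sj subrr maxxx add0r.
  - by move=> j; rewrite -ltNge; exact: tQ.
pose E j := ((N A `^ (p - 1))^-1)%:C
    *: (A *m psdpow M ((p - 2) / 2) *m (v j *m (v j)^t*)).
(* Both sides send v_j to c t_j sigma_j^(p-1) w_j, with c = N(A)^(1-p). *)
have -> : G = \sum_j (t j)%:C *: E j.
  apply: (onb_ext ov) => j; have [_ Avj Gvj _ _] := hw j.
  have -> : \sum_j (t j)%:C *: E j = ((N A `^ (p - 1))^-1)%:C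
      *: (A *m psdpow M ((p - 2) / 2) *m \sum_j (t j)%:C *: (v j *m (v j)^t*)).
    rewrite mulmx_sumr scaler_sumr; apply: eq_bigr => i _.
    by rewrite /E -scalemxAr !scalerA mulrC.
  rewrite -scalemxAl -mulmxA rank1_sum_mul // -scalemxAr -mulmxA.
  rewrite (psdpow_singval p (s_ge0 j) (Av j)) -scalemxAr Avj Gvj !scalerA.
  rewrite -!rmorphM gE tf -(powR_mulB2 p_ge2 (s_ge0 j)).
  by congr (_%:C *: _); rewrite !mulrA.
apply: (hypersimplex_hull cS) sumt tP tQ => // J cardJ ltJ Jge.
have [u [ou Au sumu]] := face_of_set ov Av cardJ ltJ Jge.
rewrite -scaler_sumr -mulmx_sumr sumu; exact: faceS.
Qed.

End Main.

Theorem theorem2p4 (R : realType) (m n : nat) (A : 'M[R[i]]_(m, n))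
    (p : R) (k : nat) (A_neq0 : A != 0) (p_ge2 : 2 <= p)
    (k_gt0 : (1 <= k)%N) (k_le : (k <= minn m n)%N) :
  subdifferential (kyfan p k) A =
  conv_hull [set G : 'M[R[i]]_(m, n) | exists v : 'I_k -> 'cV[R[i]]_n,
    [/\ orthonormal_fam v,
        forall i : 'I_k,
          A^t* *m A *m v i = (singval A i ^+ 2)%:C *: v i
      & G = ((kyfan p k A `^ (p - 1))^-1)%:C
              *: (A *m psdpow (A^t* *m A) ((p - 2) / 2)
                    *m \sum_(i < k) (v i *m (v i)^t*))]].
Proof.
have k_le_n : (k <= n)%N := leq_trans k_le (geq_minr m n).
apply/seteqP; split=> [G subG S [cS faceS]|].
  apply: (subgradient_in_hull p_ge2 k_gt0 k_le_n A_neq0 subG cS) => v ov Av.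
  by apply: faceS; exists v.
apply: smallest_sub; first exact: subdifferential_convex.
move=> G [v [ov Av ->]].
exact: (kyfan_face_sub p_ge2 k_gt0 k_le_n A_neq0 ov Av).
Qed.
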